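(* A descending framework is exact, polyhedral, and well-connected.
   Context: Setting: $I$ finite, $|I|=n$; $B=[b_{ij}]$ skew-symmetrizable integer matrix ($\delta(i)b_{ij}=-\delta(j)b_{ji}$, $\delta>0$); $V$ with basis of simple roots $\{\alpha_i\}$, simple co-roots $\alpha_i^\vee=\delta(i)^{-1}\alpha_i$; $V^*$ dual with pairing $\langle\cdot,\cdot\rangle$; $\omega(\alpha_i^\vee,\alpha_j)=b_{ij}$; $[x]_+=\max(x,0)$. Framework: quasi-graphs are simple hypergraphs with half-edges (size 1) and full edges (size 2); degree counts all edges; connected = connected after removing half-edges; $I(v)$ = edges at $v$. A framework for $B$ is $(G,C,C^\vee)$, $G$ connected and $n$-regular, with $C(v,e),C^\vee(v,e)\in V$ ($\beta^\vee:=C^\vee(v,e)$ for $\beta=C(v,e)$) such that: $C^\vee(v,e)$ is a positive multiple of $C(v,e)$; $C(v,e)\ne0$ and $\pm C(v,e)$ is in the nonnegative span of simple roots (giving $\operatorname{sgn}\in\{\pm1\}$, same for co-label); some $v_b$ has $C(v_b)=\{\alpha_i\}$, $C^\vee(v_b)=\{\alpha_i^\vee\}$ (identifying $I(v_b)$ with $I$); for distinct $v,v'$ on an edge $e$: $C(v',e)=-C(v,e)$, $C^\vee(v',e)=-C^\vee(v,e)$, and for $\beta=C(v,e)$, $\gamma\in C(v)\setminus\{\beta\}$, $\gamma+[\operatorname{sgn}(\beta)\omega(\beta^\vee,\gamma)]_+\beta\in C(v')$ and $\gamma^\vee+[-\operatorname{sgn}(\beta^\vee)\omega(\gamma^\vee,\beta)]_+\beta^\vee\in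 C^\vee(v')$. For a full edge $e$ joining $v,v'$, $\mu_e:I(v)\to I(v')$ has $\mu_e(e)=e$ and for $g\ne e$, $\mu_e(g)$ is the $g'$ with $C(v',g')=C(v,g)+[\operatorname{sgn}(C(v,e))\omega(C^\vee(v,e),C(v,g))]_+C(v,e)$. Descending: orient each full edge $e$ at $v$ towards $v$ if $\operatorname{sgn}(C(v,e))=1$ and away from $v$ if it is $-1$. The framework is descending if (Positive labels) any vertex all of whose labels have sign $1$ is $v_b$; (Half-edge) every half-edge $e$ at $v$ has $\operatorname{sgn}(C(v,e))=1$; (Descending chain) there is no infinite directed path $v_0\to v_1\to\cdots$. $\mathrm{Cone}(v)=\{x\in V^*:\langle x,C^\vee(v,e)\rangle\ge0\ \forall e\in I(v)\}$. Polyhedral: the cones $\mathrm{Cone}(v)$, $v$ a vertex of $G$, are the maximal cones of a fan (a collection of closed polyhedral cones closed under taking faces, any two intersecting in a common face), and distinct vertices give distinct cones. Well-connected (for polyhedral frameworks): whenever $F$ is a face of $\mathrm{Cone}(v)$ and of $\mathrm{Cone}(v')$, there is a path $v=v_0,v_1,\dots,v_k=v'$ in $G$ with $F$ a face of every $\mathrm{Cone}(v_i)$. Exact: let $\hat G$ be the universal cover at $v_b$ (vertices are sequences $(u_0,\dots,u_k)$, $u_0=v_b$, $u_{i-1},u_i$ joined by an edge $e_i$, $e_i\ne e_{i+1}$, projecting to $u_k$). Let $\mathcal{A}_0(B)$ be the principal-coefficients cluster algebra (initial cluster $(x_i)$, frozen $(y_i)$, extended exchange matrix $\binom{B}{\mathrm{Id}}$;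 mutation at $k$: $\tilde b'_{pq}=-\tilde b_{pq}$ if $p=k$ or $q=k$, else $\tilde b_{pq}+\operatorname{sgn}(\tilde b_{pk})[\tilde b_{pk}\tilde b_{kq}]_+$, and $x_k\mapsto x_k^{-1}(\prod_pz_p^{[\tilde b_{pk}]_+}+\prod_pz_p^{[-\tilde b_{pk}]_+})$). $\operatorname{Seed}(u_0,\dots,u_k)$ is obtained from the initial seed by successive mutations at $e_1,\dots,e_k$, indices transported by $\mu_{e_j}$. Ample: $\operatorname{Seed}(\tilde v)$, up to relabeling indices, depends only on the projection of $\tilde v$ to $G$. Injective: for vertices $u,v$ of $G$, $C(u)=C(v)$, $C^\vee(u)=C^\vee(v)$ and $u=v$ are equivalent. Exact: injective and ample. *)

(* Defs.v *)
From HB Require Import structures.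
From mathcomp Require Import all_boot all_order all_algebra all_fingroup.
From mathcomp Require Import boolp classical_sets functions cardinality reals.
From mathcomp Require Import mpoly.

Set Implicit Arguments.
Unset Strict Implicit.
Unset Printing Implicit Defensive.

Import Order.TTheory GRing.Theory Num.Theory.
Local Open Scope classical_set_scope.
Local Open Scope card_scope.
Local Open Scope ring_scope.

Definition pos_part (R : numDomainType) (x : R) : R := Num.max x 0.

Definition skew_symmetrized_by (R : realType) (I : finType)
    (B : I -> I -> int) (delta : I -> R) : Prop :=
  (forall i, 0 < delta i) /\
  (forall i j, delta i * (B i j)%:~R = - (delta j * (B j i)%:~R)).

(* [rootspace R I] is V, in coordinates with respect to the simple roots;
   [coweightspace R I] is its dual V^*, in coordinates with respect to the
   basis dual to the simple roots. *)
Definition rootspace (R : realType) (I : finType) := {ffun I -> R^o}.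
Definition coweightspace (R : realType) (I : finType) := {ffun I -> R^o}.

Section RootSpace.
Variables (R : realType) (I : finType) (B : I -> I -> int) (delta : I -> R).

Definition pairing (x : coweightspace R I) (b : rootspace R I) : R :=
  \sum_i x i * b i.

Definition simple_root (i : I) : rootspace R I := [ffun j => (j == i)%:R].

Definition simple_coroot (i : I) : rootspace R I :=
  (delta i)^-1 *: simple_root i.

Definition omega (a b : rootspace R I) : R :=
  \sum_i \sum_j a i * delta i * (B i j)%:~R * b j.

Lemma omega_simple (i j : I) : delta i != 0 ->
  omega (simple_coroot i) (simple_root j) = (B i j)%:~R.
Proof.
move=> di; rewrite /omega (bigD1 i) //= [X in _ + X]big1 ?addr0; last first.
  move=> k ki; apply: big1 => l _.
  by rewrite !ffunE (negPf ki) scaler0 !mul0r.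
rewrite (bigD1 j) //= big1 ?addr0; last first.
  by move=> l lj; rewrite !ffunE (negPf lj) mulr0.
by rewrite !ffunE !eqxx mulr1 /GRing.scale /= mulr1 mulVf // mul1r.
Qed.

Definition nonneg_root (b : rootspace R I) : bool := [forall i, 0 <= b i].

(* Meaningful when b != 0 and one of b, - b is in the nonnegative span of the
   simple roots, which is an axiom for labels. *)
Definition root_sgn (b : rootspace R I) : R :=
  if nonneg_root b then 1 else -1.

Definition label_mutation (b bv c : rootspace R I) : rootspace R I :=
  c + pos_part (root_sgn b * omega bv c) *: b.

Definition colabel_mutation (b bv cv : rootspace R I) : rootspace R I :=
  cv + pos_part (- root_sgn bv * omega cv b) *: bv.

Definition polyhedral_cone (K : set (coweightspace R I)) : Prop :=
  exists s : seq (rootspace R I),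
    K = [set x | forall a, a \in s -> 0 <= pairing x a].

Definition is_face (F K : set (coweightspace R I)) : Prop :=
  exists a : rootspace R I,
    (forall x, K x -> 0 <= pairing x a) /\
    F = [set x | K x /\ pairing x a = 0].

Definition is_fan (Phi : set (set (coweightspace R I))) : Prop :=
  [/\ forall K, Phi K -> polyhedral_cone K,
      forall K F, Phi K -> is_face F K -> Phi F &
      forall K L, Phi K -> Phi L ->
        is_face (K `&` L) K /\ is_face (K `&` L) L].

Definition maximal_cone (Phi : set (set (coweightspace R I)))
    (K : set (coweightspace R I)) : Prop :=
  Phi K /\ forall L, Phi L -> K `<=` L -> L = K.

End RootSpace.

(* Simplicity concerns full edges only: several half-edges may hang from the
   same vertex. *)
Record quasi_graph := QuasiGraph {
  vertex : Type;
  edge : Type;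
  ends : edge -> set vertex;
  ends_size : forall e, ends e #= `I_1 \/ ends e #= `I_2;
  simple_full : forall e e', ends e #= `I_2 -> ends e = ends e' -> e = e'
}.

Section QuasiGraph.
Variable G : quasi_graph.

Definition half_edge (e : edge G) : Prop := ends e #= `I_1.

Definition incident (v : vertex G) : set (edge G) := [set e | ends e v].

Definition joins (e : edge G) (v w : vertex G) : Prop :=
  v <> w /\ ends e = [set v; w].

Definition is_path (k : nat) (p : nat -> vertex G) (v w : vertex G) : Prop :=
  [/\ p 0%N = v, p k = w &
      forall i, (i < k)%N -> exists e, joins e (p i) (p i.+1)].

Definition connected_graph : Prop := forall v w, exists k p, is_path k p v w.

Definition regular (n : nat) : Prop := forall v, incident v #= `I_n.

End QuasiGraph.

(* The labels lab v e and colab v e matter only when e is incident to v. *)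
Record framework (R : realType) (I : finType) (B : I -> I -> int)
    (delta : I -> R) := Framework {
  graph : quasi_graph;
  base : vertex graph;
  lab : vertex graph -> edge graph -> rootspace R I;
  colab : vertex graph -> edge graph -> rootspace R I;
  graph_connected : connected_graph graph;
  graph_regular : regular graph #|I|;
  colab_multiple : forall v e, incident v e ->
        exists c : R, 0 < c /\ colab v e = c *: lab v e;
  lab_sign : forall v e, incident v e ->
        lab v e <> 0 /\ (nonneg_root (lab v e) \/ nonneg_root (- lab v e));
  lab_base : lab base @` incident base = range (@simple_root R I);
  colab_base : colab base @` incident base = range (simple_coroot delta);
  lab_opp : forall v w e, joins e v w ->
        lab w e = - lab v e /\ colab w e = - colab v e;
  lab_transition : forall v w e g, joins e v w -> incident v g ->
        lab v g <> lab v e ->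
        (lab w @` incident w)
          (label_mutation B delta (lab v e) (colab v e) (lab v g)) /\
        (colab w @` incident w)
          (colabel_mutation B delta (lab v e) (colab v e) (colab v g))
}.

Section Descending.
Variables (R : realType) (I : finType) (B : I -> I -> int) (delta : I -> R).
Variable Fr : framework B delta.
Local Notation G := (graph Fr).

Definition arrow (v w : vertex G) : Prop :=
  exists e, joins e v w /\ root_sgn (lab v e) = -1.

Definition descending : Prop :=
  [/\ forall v : vertex G,
        (forall e, incident v e -> root_sgn (lab v e) = 1) -> v = base Fr,
      forall (v : vertex G) e,
        incident v e -> half_edge e -> root_sgn (lab v e) = 1 &
      ~ exists p : nat -> vertex G, forall i, arrow (p i) (p i.+1)].

Definition cone (v : vertex G) : set (coweightspace R I) :=
  [set x | forall e, incident v e -> 0 <= pairing x (colab v e)].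

Definition polyhedral : Prop :=
  (exists Phi : set (set (coweightspace R I)),
     is_fan Phi /\
     forall K, maximal_cone Phi K <-> exists v, K = cone v) /\
  (forall v w, cone v = cone w -> v = w).

Definition well_connected : Prop :=
  forall (v w : vertex G) (F : set (coweightspace R I)),
    is_face F (cone v) -> is_face F (cone w) ->
    exists k p, is_path k p v w /\
      forall i, (i <= k)%N -> is_face F (cone (p i)).

Definition injective_framework : Prop :=
  forall u v : vertex G,
    [/\ lab u @` incident u = lab v @` incident v <-> u = v &
        colab u @` incident u = colab v @` incident v <-> u = v].

End Descending.

Section Seeds.
Variables (I : finType) (B : I -> I -> int).

(* The field of rational functions over Q in the initial cluster variables
   (indexed by [inl i]) and the frozen variables (indexed by [inr i]). *)
Definition ambient_field := {fraction {mpoly rat[#|{: I + I}|]}}.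

Definition ambient_var (p : I + I) : ambient_field :=
  FracField.tofrac 'X_(enum_rank p).

(* Rows [inl i] of the extended exchange matrix form the exchange matrix,
   rows [inr i] are the coefficient rows. *)
Record seed := Seed {
  cluster_var : I -> ambient_field;
  ext_matrix : I + I -> I -> int
}.

Definition initial_seed : seed := {|
  cluster_var := fun i => ambient_var (inl i);
  ext_matrix := fun p j =>
    match p with inl i => B i j | inr i => (i == j)%:Z end |}.

Definition seed_var (S : seed) (p : I + I) : ambient_field :=
  match p with inl i => cluster_var S i | inr i => ambient_var (inr i) end.

Definition exchange_monomial (S : seed) (m : I + I -> int) : ambient_field :=
  \prod_p seed_var S p ^+ `|pos_part (m p)|%N.

Definition mutate (k : I) (S : seed) : seed := {|
  cluster_var := fun q =>
    if q == k then
      (cluster_var S k)^-1 *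
        (exchange_monomial S (fun p => ext_matrix S p k) +
         exchange_monomial S (fun p => - ext_matrix S p k))
    else cluster_var S q;
  ext_matrix := fun p q =>
    if (p == inl k) || (q == k) then - ext_matrix S p q
    else ext_matrix S p q +
         Num.sg (ext_matrix S p k) *
           pos_part (ext_matrix S p k * ext_matrix S (inl k) q) |}.

Definition same_up_to_relabeling (S T : seed) : Prop :=
  exists s : {perm I},
    (forall i, cluster_var T (s i) = cluster_var S i) /\
    (forall i j, ext_matrix T (inl (s i)) (s j) = ext_matrix S (inl i) j) /\
    (forall i j, ext_matrix T (inr i) (s j) = ext_matrix S (inr i) j).

End Seeds.

Section Exact.
Variables (R : realType) (I : finType) (B : I -> I -> int) (delta : I -> R).
Variable Fr : framework B delta.
Local Notation G := (graph Fr).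

(* The map mu_e : I(v) -> I(w), for e joining v and w. *)
Definition edge_transport (v w : vertex G) (e g : edge G) : edge G :=
  if `[< g = e >] then e
  else @xget {classic edge G} g
         [set h : edge G | incident w h /\
            lab w h = label_mutation B delta (lab v e) (colab v e) (lab v g)].

(* The identification of I with I(base); the condition determines the edge,
   so the default value is irrelevant. *)
Definition base_index (e0 : edge G) (i : I) : edge G :=
  @xget {classic edge G} e0
    [set e : edge G | incident (base Fr) e /\
                      lab (base Fr) e = simple_root R i].

(* A vertex (u_0, ..., u_k) of the universal cover is encoded by the steps
   [:: (e_1, u_1); ...; (e_k, u_k)]; u_0 is the base. *)
Fixpoint cover_from (u : vertex G) (prev : option (edge G))
    (s : seq (edge G * vertex G)) : Prop :=
  match s with
  | [::] => True
  | (e, w) :: s' =>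
      [/\ joins e u w, prev <> Some e & cover_from w (Some e) s']
  end.

Definition cover_vertex (s : seq (edge G * vertex G)) : Prop :=
  cover_from (base Fr) None s.

Definition cover_proj (s : seq (edge G * vertex G)) : vertex G :=
  last (base Fr) [seq eu.2 | eu <- s].

(* Seeds stay indexed by I; [idx : I -> edge G] records the current
   identification of I with the edges at the vertex u reached so far. *)
Fixpoint seed_from (u : vertex G) (idx : I -> edge G) (S : seed I)
    (s : seq (edge G * vertex G)) : seed I :=
  match s with
  | [::] => S
  | (e, w) :: s' =>
      seed_from w (fun i => edge_transport u w e (idx i))
        (if [pick k | `[< idx k = e >]] is Some k then mutate k S else S) s'
  end.

Definition cover_seed (s : seq (edge G * vertex G)) : seed I :=
  match s with
  | [::] => initial_seed B
  | (e, _) :: _ => seed_from (base Fr) (base_index e) (initial_seed B) s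
  end.

Definition ample : Prop :=
  forall s t, cover_vertex s -> cover_vertex t ->
    cover_proj s = cover_proj t ->
    same_up_to_relabeling (cover_seed s) (cover_seed t).

Definition exact_framework : Prop := injective_framework Fr /\ ample.

End Exact.

(* Main.v *)
(** Let rho be the coweight pairing to 1 with every simple root: the sign of a
    label is the sign of its pairing with rho, so an arrow crosses a wall towards
    the dominant cone of the base vertex, and the descending chain condition makes
    induction along arrows available.  At every vertex the labels form a basis.

    Disjointness of the interiors of two cones: move a generic common interior
    point along rho until a first wall is met, cross it downwards and apply the
    induction hypothesis.  For a point x of Cone(v), crossing negative walls through
    x as long as possible leads to the unique vertex whose cone contains
    x + eps rho in its interior; these crossings do not change the minimal face
    containing x.  Hence cones sharing x have the same minimal face there and are
    linked through cones containing it, which gives the fan and its connectivity.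

    For ampleness, two upward paths to v whose last steps are distinct walls e, f
    are compared inside the star of the codimension-two face cut out by e and f:
    both sides of that star descend to the same vertex u, along alternating
    mutations in two directions.  Positivity of the labels forces the rank-two
    exchange matrix at u to be of finite type, and the periodicity of the rank-two
    exchange recurrence (periods 4, 5, 6, 8) shows that both sides of the polygon
    produce the same cluster variables. *)

Require Import Defs.
From mathcomp Require Import all_boot all_order all_algebra all_fingroup.
From mathcomp Require Import boolp classical_sets functions cardinality reals.
From mathcomp Require Import mpoly zify ring lra.

Set Implicit Arguments.
Unset Strict Implicit.
Unset Printing Implicit Defensive.

Import Order.TTheory GRing.Theory Num.Theory.
Local Open Scope classical_set_scope.
Local Open Scope card_scope.
Local Open Scope ring_scope.

(** * Root spaces *)

(** The labels at a vertex are the c-vectors of its seed: the exchange matrix is recovered from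
    labels and co-labels through [omega], and the coefficient rows are the coordinates of the
    labels. Two seeds reached at one vertex can therefore differ, up to indexing, only in their
    cluster variables, and ampleness becomes a statement about these alone. That every label has a
    sign plays the role of sign-coherence.

    The graph may be infinite, and the star of a codimension-two face could a priori be an unending
    strip. It closes because the heights (pairings with rho) of the walls crossed while climbing
    satisfy t_(j+2) = e_j t_(j+1) - t_j, where e_j alternates between the absolute exchange entries
    a and c. For ac >= 4 these heights would stay positive for ever, whereas at the top vertex both
    labels of the star are negative.

    The rank-two recurrence carries arbitrary coefficients, which evolve piecewise linearly.
    Dividing each variable by a suitable monomial turns all coefficients into monomials in two
    quantities, which splits periodicity into an identity of rational functions and a
    piecewise-linear identity of exponents. *)

Lemma pos_partE (R : realDomainType) (x : R) :
  pos_part x = if 0 <= x then x else 0.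
Proof.
by rewrite /pos_part; case: leP.
Qed.

Lemma pos_part_ge0 (R : realDomainType) (x : R) : 0 <= pos_part x.
Proof. by rewrite pos_partE; case: ifP. Qed.

Lemma pos_part_sub (R : realDomainType) (x : R) :
  pos_part x - pos_part (- x) = x.
Proof.
rewrite !pos_partE oppr_ge0; case: ltrgt0P => [x0|x0|->]; lra.
Qed.

Lemma pos_partM (R : realDomainType) (c x : R) : 0 <= c ->
  pos_part (c * x) = c * pos_part x.
Proof. by move=> c0; rewrite /pos_part maxr_pMr ?mulr0. Qed.

Lemma pos_part_intr (R : realDomainType) (n : int) :
  (pos_part n)%:~R = pos_part (n%:~R : R).
Proof. by rewrite !pos_partE ler0z; case: ifP. Qed.

(* The mutation rule for the exchange matrix may be written with either sign. *)
Lemma mutation_sign (R : realDomainType) (s b d : R) : s = 1 \/ s = -1 ->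
  b * pos_part (s * d) + pos_part (- s * b) * d = Num.sg b * pos_part (b * d).
Proof.
move=> hs; have hd := congr1 ( *%R b) (pos_part_sub d).
have h0 (x : R) : 0 <= x -> (pos_part x = x) * (pos_part (- x) = 0).
  move=> x0; rewrite !pos_partE x0 oppr_ge0; split=> //.
  by case: ifP => // x0'; rewrite (@le_anti _ _ x 0) ?oppr0 // x0 x0'.
have [b0|b0|->] := ltrgt0P b; last first.
- by rewrite mulr0 sgr0 !mul0r (h0 0 _).1 ?mul0r ?addr0.
- have b1 : 0 <= - b by rewrite oppr_ge0 ltW.
  rewrite (ltr0_sg b0) -[b * d]mulrNN (pos_partM (- d) b1).
  have := h0 _ b1; rewrite opprK => -[hNb hb].
  case: hs => ->; rewrite ?(mul1r, mulN1r, opprK, mulrN, mulNr) ?hNb ?hb.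
    by lra.
  by rewrite mul0r addr0.
rewrite (gtr0_sg b0) (pos_partM d (ltW b0)) mul1r.
case: hs => ->; rewrite ?(opprK, mul1r, mulN1r) ?(h0 _ (ltW b0)).1 ?(h0 _ (ltW b0)).2.
  by rewrite mul0r addr0.
by lra.
Qed.

(** Regularity enters through this count: an injective indexing by I of edges at a vertex is
    automatically exhaustive. *)
Lemma injective_surj_on (I : finType) (T : Type) (A : set T) (f : I -> T) :
  A #= `I_#|I| -> injective f -> (forall i, A (f i)) ->
  forall t, A t -> exists i, f i = t.
Proof.
move=> /card_set_bijP[h [hA hinj _]] finj fA t At.
have hlt u : A u -> (h u < #|I|)%N by move=> Au; apply: (hA _ Au).
pose q i := Ordinal (hlt _ (fA i)).
have qinj : injective q.
  by move=> i j [] /hinj; rewrite !in_setE => /(_ (fA i) (fA j)) /finj.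
have [i hi] : exists i, q i = Ordinal (hlt _ At).
  have /(_ (Ordinal (hlt _ At))) : forall y, y \in codom q.
    by apply: inj_card_onto qinj _; rewrite card_ord.
  by move=> /codomP[i ->]; exists i.
exists i; move/(congr1 val): hi => /= /hinj; rewrite !in_setE; exact.
Qed.

Section Pairing.
Variables (R : realType) (I : finType).
Implicit Types (x y : coweightspace R I) (a b : rootspace R I).

Lemma pairingDl x y b : pairing (x + y) b = pairing x b + pairing y b.
Proof. by rewrite -big_split; apply: eq_bigr => i _; rewrite ffunE mulrDl. Qed.

Lemma pairingDr x a b : pairing x (a + b) = pairing x a + pairing x b.
Proof. by rewrite -big_split; apply: eq_bigr => i _; rewrite ffunE mulrDr. Qed.

Lemma pairingZl c x b : pairing (c *: x) b = c * pairing x b.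
Proof. by rewrite mulr_sumr; apply: eq_bigr => i _; rewrite ffunE -mulrA. Qed.

Lemma pairingZr c x b : pairing x (c *: b) = c * pairing x b.
Proof. by rewrite mulr_sumr; apply: eq_bigr => i _; rewrite ffunE mulrCA. Qed.

Lemma pairingNr x b : pairing x (- b) = - pairing x b.
Proof. by rewrite -scaleN1r pairingZr mulN1r. Qed.

Lemma pairing0l b : pairing 0 b = 0.
Proof. by rewrite /pairing big1 // => i _; rewrite ffunE mul0r. Qed.

Lemma pairing0r x : pairing x 0 = 0.
Proof. by rewrite /pairing big1 // => i _; rewrite ffunE mulr0. Qed.

Lemma pairing_suml (J : finType) (P : pred J) (F : J -> coweightspace R I) b :
  pairing (\sum_(j | P j) F j) b = \sum_(j | P j) pairing (F j) b.
Proof.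
by apply: (big_morph (fun x => pairing x b)) => [x y|];
  rewrite ?pairingDl ?pairing0l.
Qed.

Lemma pairing_sumr (J : finType) (P : pred J) (F : J -> rootspace R I) x :
  pairing x (\sum_(j | P j) F j) = \sum_(j | P j) pairing x (F j).
Proof.
by apply: (big_morph (pairing x)) => [a b|]; rewrite ?pairingDr ?pairing0r.
Qed.

Definition rho : coweightspace R I := [ffun=> 1].


Lemma root_sgn_cases b : root_sgn b = 1 \/ root_sgn b = -1.
Proof. by rewrite /root_sgn; case: ifP; [left|right]. Qed.

Lemma root_sgn_scale c b : 0 < c -> root_sgn (c *: b) = root_sgn b.
Proof.
move=> c0; rewrite /root_sgn; congr (if _ then _ else _).
by apply/forallP/forallP => h i; move: (h i); rewrite ffunE pmulr_rge0.
Qed.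

Lemma nonneg_root_rho b : nonneg_root b -> b <> 0 -> 0 < pairing rho b.
Proof.
move=> /forallP b0 bn0; rewrite lt_neqAle sumr_ge0 ?andbT; last first.
  by move=> i _; rewrite ffunE mul1r.
rewrite eq_sym; apply/negP => /eqP h; apply: bn0; apply/ffunP => i.
have /psumr_eq0P /(_ h) /(_ i isT) : forall j, true -> 0 <= rho j * b j.
  by move=> j _; rewrite ffunE mul1r.
by rewrite !ffunE mul1r.
Qed.

Lemma root_sgn_rho b : b <> 0 -> nonneg_root b \/ nonneg_root (- b) ->
  (root_sgn b = 1 <-> 0 < pairing rho b) /\
  (root_sgn b = -1 <-> pairing rho b < 0).
Proof.
move=> bn0 hb; have n11 : (1 : R) <> -1 by lra.
rewrite /root_sgn; case: ifP hb => [nb _|nb [//|nNb]].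
  have := nonneg_root_rho nb bn0; split; split => //; lra.
have := nonneg_root_rho nNb; rewrite pairingNr => h.
have : 0 < - pairing rho b by apply: h => /eqP; rewrite oppr_eq0 => /eqP.
split; split => //; lra.
Qed.

End Pairing.

Section Omega.
Variables (R : realType) (I : finType) (B : I -> I -> int) (delta : I -> R).
Implicit Types (a b c : rootspace R I).
Local Notation om := (omega B delta).

Lemma omegaDl a b c : om (a + b) c = om a c + om b c.
Proof.
rewrite -big_split; apply: eq_bigr => i _; rewrite -big_split; apply: eq_bigr => j _.
by rewrite ffunE !mulrDl.
Qed.

Lemma omegaDr a b c : om a (b + c) = om a b + om a c.
Proof.
rewrite -big_split; apply: eq_bigr => i _; rewrite -big_split; apply: eq_bigr => j _.
by rewrite ffunE !mulrDr.
Qed.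

Lemma omegaZl k a b : om (k *: a) b = k * om a b.
Proof.
rewrite mulr_sumr; apply: eq_bigr => i _; rewrite mulr_sumr; apply: eq_bigr => j _.
by rewrite ffunE -!mulrA.
Qed.

Lemma omegaZr k a b : om a (k *: b) = k * om a b.
Proof.
rewrite mulr_sumr; apply: eq_bigr => i _; rewrite mulr_sumr; apply: eq_bigr => j _.
by rewrite ffunE [_ *: _]/(k * _) mulrCA.
Qed.

Lemma omegaNl a b : om (- a) b = - om a b.
Proof. by rewrite -scaleN1r omegaZl mulN1r. Qed.

Lemma omegaNr a b : om a (- b) = - om a b.
Proof. by rewrite -scaleN1r omegaZr mulN1r. Qed.

Lemma omegaC a b : skew_symmetrized_by B delta -> om a b = - om b a.
Proof.
case=> _ sk; rewrite /omega exchange_big -sumrN; apply: eq_bigr => i _.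
rewrite -sumrN; apply: eq_bigr => j _.
by rewrite -[a j * _ * _]mulrA sk; ring.
Qed.

Lemma omega_self a : skew_symmetrized_by B delta -> om a a = 0.
Proof. by move=> /(omegaC a a) h; lra. Qed.

End Omega.

(** * Labels along edges *)

Section QuasiGraphLemmas.
Variable G : quasi_graph.
Implicit Types (v w : vertex G) (e : edge G).

Lemma joinsC e v w : joins e v w -> joins e w v.
Proof. by case=> vw eE; split; [exact: nesym|rewrite eE setUC]. Qed.

Lemma joins_incl e v w : joins e v w -> incident v e.
Proof. by case=> _ eE; rewrite /incident /= eE; left. Qed.

Lemma joins_inj e v w w' : joins e v w -> joins e v w' -> w = w'.
Proof.
case=> vw ew [vw' ew']; have : ends e w by rewrite ew; right.
by rewrite ew' => -[/esym//|].
Qed.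

Lemma full_edge_joins v e : incident v e -> ~ half_edge e ->
  exists w, joins e v w.
Proof.
move=> ve; case: (ends_size e) => // /card_set_bijP[f [f1 f2 f3]] _.
have fv := f1 _ ve; rewrite /= in fv.
(* [f] takes the values 0 and 1 on the two ends; the other end is the one with the other value. *)
have [w ew fw] := f3 (1 - f v)%N ltac:(rewrite /=; lia).
have vw : v <> w by move=> e1; move: fw; rewrite e1; lia.
exists w; split=> //; apply/seteqP; split => u /=; last by case=> ->.
move=> eu; have := f1 _ eu; rewrite /= => fu.
have [h|h] : f u = f v \/ f u = f w by lia.
  by left; apply: f2 h; rewrite in_setE.
by right; apply: f2 h; rewrite in_setE.
Qed.

End QuasiGraphLemmas.

(** * Markings: the labels at a vertex as c-vectors of a seed *)

Section Marking.
Variables (R : realType) (I : finType) (B : I -> I -> int) (delta : I -> R).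
Hypothesis HB : skew_symmetrized_by B delta.
Variable Fr : framework B delta.
Local Notation G := (graph Fr).
Local Notation rho := (rho R I).
Implicit Types (v w : vertex G) (e : edge G) (E : I -> edge G) (S : seed I).

Lemma incident_sgn v e : incident v e ->
  (root_sgn (lab v e) = 1 <-> 0 < pairing rho (lab v e)) /\
  (root_sgn (lab v e) = -1 <-> pairing rho (lab v e) < 0).
Proof. by move=> /(@lab_sign _ _ _ _ Fr)[]; exact: root_sgn_rho. Qed.

Lemma incident_rho_neq0 v e : incident v e -> pairing rho (lab v e) != 0.
Proof.
move=> ve; have [h1 h2] := incident_sgn ve; apply/eqP => h.
by case: (root_sgn_cases (lab v e)) => [/h1|/h2]; rewrite h ltxx.
Qed.

(** The invariant carried along paths from the base. [marked_dual] says that the labels form a basis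
    by exhibiting the dual one, [marked_colab] fixes the scale that a framework leaves free in the
    co-labels, and the last two fields tie the extended matrix of S to the labels. Cluster variables
    are left open; [same_clusters] compares them. *)
Record marked v E S : Prop := Marked {
  marked_inj : injective E;
  marked_inc : forall i, incident v (E i);
  marked_surj : forall e, incident v e -> exists i, E i = e;
  marked_dual : exists g : I -> coweightspace R I,
    (forall i j, pairing (g i) (lab v (E j)) = (i == j)%:R) /\
    (forall x, x = \sum_i pairing x (lab v (E i)) *: g i);
  marked_colab : forall i, colab v (E i) = (delta i)^-1 *: lab v (E i);
  marked_matrix : forall i j, (ext_matrix S (inl i) j)%:~R =
    omega B delta (colab v (E i)) (lab v (E j));
  marked_coef : forall p j, (ext_matrix S (inr p) j)%:~R = lab v (E j) p :> R
}.

Lemma marked_lab_inj v E S : marked v E S -> injective (fun i => lab v (E i)).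
Proof.
move=> /marked_dual [g [gE _]] i j h; have := gE i j; rewrite -h gE eqxx.
by case: eqP => // _ /eqP; rewrite oner_eq0.
Qed.

Lemma simple_root_inj : injective (@simple_root R I).
Proof.
move=> i j /ffunP /(_ i); rewrite !ffunE eqxx.
by case: eqP => // _ /eqP; rewrite oner_eq0.
Qed.

Definition base_marking E := forall i,
  incident (base Fr) (E i) /\ lab (base Fr) (E i) = simple_root R i.

Lemma base_marking_exists : exists E, base_marking E.
Proof.
suff /boolp.choice[E hE] : forall i, exists e, incident (base Fr) e /\
    lab (base Fr) e = simple_root R i by exists E.
move=> i; have : range (@simple_root R I) (simple_root R i).
  by exists i.
by rewrite -(lab_base Fr) => -[e be h]; exists e.
Qed.

Lemma base_indexP e0 : base_marking (base_index e0).
Proof.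
move=> i; have [E hE] := base_marking_exists.
exact: (@xgetI {classic edge G} e0 [set e : edge G | incident (base Fr) e /\
  lab (base Fr) e = simple_root R i] (E i) (hE i)).
Qed.

Lemma base_marked E : base_marking E -> marked (base Fr) E (initial_seed B).
Proof.
move=> hE; have d0 := HB.1; have Einj : injective E.
  by move=> i j eij; apply: simple_root_inj; rewrite -!(hE _).2 eij.
have Einc i : incident (base Fr) (E i) by case: (hE i).
have colabE i : colab (base Fr) (E i) = (delta i)^-1 *: lab (base Fr) (E i).
  have [c [c0 cE]] := colab_multiple (Einc i).
  have : (colab (base Fr) @` incident (base Fr)) (colab (base Fr) (E i)).
    by exists (E i).
  (* The co-label is a positive multiple of the i-th simple root and also some simple co-root;
     comparing i-th coordinates forces the index i and the scale. *)
  rewrite colab_base => -[j _ /ffunP /(_ i)].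
  rewrite cE (hE i).2 !ffunE eqxx /GRing.scale /= mulr1.
  case: eqP => [-> |_]; first by rewrite mulr1 => <-.
  by rewrite mulr0 => /esym h; move: c0; rewrite h ltxx.
have pair_simple (x : coweightspace R I) i :
    pairing x (lab (base Fr) (E i)) = x i.
  rewrite (hE i).2 /pairing (bigD1 i) //= ffunE eqxx mulr1 big1 ?addr0 //.
  by move=> j /negPf ji; rewrite ffunE ji mulr0.
split=> //.
- by apply: injective_surj_on => //; exact: graph_regular.
- exists (@simple_root R I); split=> [i j|x].
    by rewrite pair_simple ffunE eq_sym.
  apply/ffunP => i; rewrite sum_ffunE (bigD1 i) //= big1 ?addr0; last first.
    by move=> j /negPf ji; rewrite !ffunE eq_sym ji [_ *: _]mulr0.
  by rewrite pair_simple !ffunE eqxx [_ *: _]mulr1.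
- move=> i j /=; rewrite colabE !(hE _).2 [RHS]omega_simple // gt_eqF //.
- by move=> p j /=; rewrite (hE j).2 ffunE.
Qed.

Definition transport v w e E i := edge_transport v w e (E i).

(** Crossing an edge negates its label b and adds multiples of b to the others, so a basis stays a
    basis. The matrix mutates accordingly because [omega] is bilinear and b is orthogonal to its own
    co-label. *)
Lemma transport_marked v w E S k : marked v E S -> joins (E k) v w ->
  let E' := transport v w (E k) E in
  marked w E' (mutate k S) /\
  forall i, lab w (E' i) = if i == k then - lab v (E k) else
    label_mutation B delta (lab v (E k)) (colab v (E k)) (lab v (E i)).
Proof.
move=> mS vw E'; have [Einj Einc Esurj [g [gE xE]] cE mE bE] := mS.
have d0 := HB.1; have di0 i : 0 < (delta i)^-1 by rewrite invr_gt0.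
set b := lab v (E k); set bv := colab v (E k).
have E'k : E' k = E k by rewrite /E' /transport /edge_transport asboolT.
(* Setting the added multiple to 0 at k gives one formula, [labE'], for all new labels. *)
pose m i := if i == k then 0 else pos_part (root_sgn b * omega B delta bv (lab v (E i))).
have mk : m k = 0 by rewrite /m eqxx.
have trans i : i != k -> _ := fun ik => lab_transition vw (Einc i)
    (fun h => negP ik (introT eqP (marked_lab_inj mS h))).
have E'E i : i != k -> incident w (E' i) /\
    lab w (E' i) = label_mutation B delta b bv (lab v (E i)).
  move=> ik; rewrite /E' /transport /edge_transport asboolF; last first.
    by move=> /Einj /eqP; rewrite (negPf ik).
  have [[h wh hE] _] := trans _ ik.
  exact: (@xgetI {classic edge G} (E i) [set h : edge G | incident w h /\
    lab w h = label_mutation B delta b bv (lab v (E i))] h (conj wh hE)).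
have E'inc i : incident w (E' i).
  have [->|/E'E[]//] := eqVneq i k.
  by rewrite E'k; apply: joins_incl (joinsC vw).
have labE i : lab w (E' i) = if i == k then - b else
    label_mutation B delta b bv (lab v (E i)).
  have [->|/E'E[]//] := eqVneq i k.
  by rewrite E'k (lab_opp vw).1.
have labE' i : lab w (E' i) = (if i == k then -1 else 1) *: lab v (E i) + m i *: b.
  rewrite labE /m; case: eqP => [->|_]; first by rewrite scale0r addr0 scaleN1r.
  by rewrite scale1r.
(* Only the k-th element of the dual basis changes: it alone pairs nontrivially with b. *)
pose g' i := if i == k then - g k + \sum_j m j *: g j else g i.
have dual' : (forall i j, pairing (g' i) (lab w (E' j)) = (i == j)%:R) /\
    (forall x, x = \sum_i pairing x (lab w (E' i)) *: g' i).
  split=> [i j|x].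
    have gm j' : pairing (\sum_j0 m j0 *: g j0) (lab v (E j')) = m j'.
      rewrite pairing_suml (bigD1 j') //= pairingZl gE eqxx mulr1 big1 ?addr0 //.
      by move=> l /negPf lj; rewrite pairingZl gE lj mulr0.
    rewrite labE' /g' pairingDr !pairingZr.
    have [->|ik] := eqVneq i k; last first.
      rewrite !gE (negPf ik) mulr0 addr0; have [->|//] := eqVneq j k.
        by rewrite (negPf ik) mulr0.
      by rewrite mul1r.
    rewrite -scaleN1r !pairingDl !pairingZl !gm !gE eqxx.
    rewrite mk [k == j]eq_sym; have [->|_] := eqVneq j k.
      by rewrite mk /=; ring.
    by rewrite /=; ring.
  rewrite {1}[x]xE (bigD1 k) //= [in RHS](bigD1 k) //= /g' eqxx labE eqxx.
  rewrite pairingNr scalerDr scaleNr scalerN opprK -addrA; congr (_ + _).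
  rewrite scaler_sumr [X in _ = X + _](bigD1 k) //= mk scale0r scaler0 add0r.
  rewrite -big_split /=; apply: eq_bigr => i ik.
  rewrite (negPf ik) labE' (negPf ik) scale1r pairingDr pairingZr scalerA -scalerDl.
  by congr (_ *: _); ring.
have E'inj : injective E'.
  move=> i j h; have := dual'.1 i j; rewrite -h dual'.1 eqxx.
  by case: eqP => // _ /eqP; rewrite oner_eq0.
have E'surj := injective_surj_on (graph_regular (f := Fr) w) E'inj E'inc.
have sgbv : root_sgn bv = root_sgn b by rewrite /bv cE root_sgn_scale.
have bvE : bv = (delta k)^-1 *: b by rewrite /bv cE.
have bvb : omega B delta bv b = 0 by rewrite bvE omegaZl omega_self ?mulr0.
(* By skew-symmetry of [omega], label and co-label mutation add the same multiple up to the scales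
   [delta]. *)
have coefE i :
    pos_part (- root_sgn b * omega B delta (colab v (E i)) b) * (delta k)^-1 =
    (delta i)^-1 * pos_part (root_sgn b * omega B delta bv (lab v (E i))).
  rewrite bvE cE !omegaZl (omegaC _ b HB) mulrN mulrNN !(mulrCA (root_sgn b)).
  rewrite !(pos_partM (root_sgn b * _)) ?ltW //.
  by ring.
have colabE i : colab w (E' i) = (delta i)^-1 *: lab w (E' i).
  have [->|ik] := eqVneq i k.
    by rewrite E'k (lab_opp vw).1 (lab_opp vw).2 cE scalerN.
  (* The axiom yields the mutated co-label on some edge h, not known to be the edge of the mutated
     label. The co-label at h is a positive multiple of [lab w h] and proportional to
     [lab w (E' i)]; pairing with [g' i] shows that h is [E' i]. *)
  have [_ [h wh hE]] := trans _ ik; have [j jE] := E'surj _ wh.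
  have [c [c0 hc]] := colab_multiple wh.
  have colm : colab w h = (delta i)^-1 *: lab w (E' i).
    rewrite hE labE (negPf ik) /colabel_mutation /label_mutation -/b -/bv sgbv.
    by rewrite [X in _ + _ *: X = _]bvE scalerA coefE -scalerA [X in X + _]cE -scalerDr.
  have : pairing (g' i) (colab w h) = (delta i)^-1.
    by rewrite colm pairingZr dual'.1 eqxx mulr1.
  rewrite hc -jE pairingZr dual'.1; have [->|_] := eqVneq i j.
    by rewrite mulr1 => <-; rewrite jE.
  by rewrite mulr0 => h0; have := di0 i; rewrite -h0 ltxx.
split=> //; split=> //.
- by exists g'.
- move=> i j /=; rewrite colabE -/E' !labE'.
  have inlk : (inl i == inl k :> I + I) = (i == k) by [].
  rewrite inlk.
  have [-> |ik] := eqVneq i k; have [-> |jk] := eqVneq j k => /=.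
  + rewrite mulrNz mE mk scale0r addr0 scaleN1r scalerN omegaNl omegaNr.
    by rewrite -/b -/bv bvE !omegaZl !omega_self // !mulr0 !oppr0.
  + rewrite mulrNz mE mk scale0r addr0 scaleN1r scale1r scalerN omegaNl.
    by rewrite -/b -bvE -/bv omegaDr omegaZr bvb mulr0 addr0.
  + rewrite mulrNz mE mk scale0r addr0 scaleN1r omegaNr cE scale1r -/b.
    by rewrite scalerDr omegaDl [_ *: (m i *: _)]scalerA [X in _ + X]omegaZl omega_self ?mulr0 ?addr0.
  rewrite intrD intrM pos_part_intr intrM !mE -/b -/bv.
  have -> : (Num.sg (ext_matrix S (inl i) k))%:~R =
      Num.sg (omega B delta (colab v (E i)) b) :> R.
    by rewrite -mE intr_sg.
  rewrite -(mutation_sign _ _ (root_sgn_cases b)) !scale1r scalerDr -cE.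
  rewrite omegaDl !omegaDr omegaZr /m (negPf ik) (negPf jk) -addrA; congr (_ + _).
  rewrite mulrC; congr (_ + _).
  rewrite scalerA !omegaZl omegaZr omega_self // !mulr0 addr0 -coefE.
  by rewrite bvE omegaZl mulrA.
move=> p j; have [-> |jk] := eqVneq j k; rewrite labE'.
  by rewrite /= eqxx mulrNz bE mk scale0r addr0 scaleN1r ffunE.
rewrite /= (negPf jk) /m (negPf jk).
rewrite intrD intrM pos_part_intr intrM intr_sg !bE mE -/b -/bv.
rewrite !ffunE scale1r; congr (_ + _).
set o := omega _ _ _ _.
rewrite -(mutation_sign _ _ (root_sgn_cases b)) [_ *: _]mulrC.
have [_ hb] := lab_sign (Einc k).
(* The coordinates of b all have the sign of b, so one of the two terms of the mutation rule
   vanishes and the coefficient row mutates as the label does. *)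
suff -> : pos_part (- root_sgn b * b p) = 0 by rewrite mul0r addr0.
rewrite /root_sgn; case: ifP hb => [h _|_ [//|h]];
    have /forallP/(_ p) := h; rewrite -/b ?ffunE ?oppr_ge0 pos_partE => bp.
  rewrite mulN1r oppr_ge0; case: ifP => // bp'.
  by rewrite (@le_anti _ _ (b p) 0) ?oppr0 // bp bp'.
by rewrite opprK mul1r; case: ifP => // bp'; apply: le_anti; rewrite bp bp'.
Qed.

End Marking.

(** * Interiors of cones are disjoint *)

Section GenericPoints.
Variables (R : realType) (I : finType).
Implicit Types (x y : coweightspace R I) (b l : rootspace R I) (L D : seq (rootspace R I)).
Local Notation rho := (rho R I).

(** Positivity of l at x moved infinitesimally in the direction y. *)
Definition lex_positive x y l := 0 < pairing x l \/ (pairing x l = 0 /\ 0 < pairing y l).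

Lemma lex_positive_perturb L x y : (forall l, l \in L -> lex_positive x y l) ->
  exists2 eps : R, 0 < eps & forall h, 0 < h <= eps ->
    forall l, l \in L -> 0 < pairing (x + h *: y) l.
Proof.
elim: L => [|l L IH] hL; first by exists 1.
have [l' l'L|eps e0 he] := IH; first by apply: hL; rewrite in_cons l'L orbT.
have [d d0 hd] : exists2 d : R, 0 < d &
    forall h, 0 < h <= d -> 0 < pairing (x + h *: y) l.
  have [|xl|[xl yl]] := hL l; first exact: mem_head.
    have Y0 : 0 < 1 + `|pairing y l| by rewrite ltr_pwDl.
    exists (pairing x l / (1 + `|pairing y l|)); first exact: divr_gt0.
    move=> h /andP[h0]; rewrite ler_pdivlMr // pairingDl pairingZl => hh.
    have := ler_norm (- pairing y l); rewrite normrN => hy.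
    have hN := normr_ge0 (pairing y l).
    by nra.
  exists 1 => // h /andP[h0 _]; rewrite pairingDl pairingZl xl add0r.
  exact: mulr_gt0.
exists (Num.min eps d); first by rewrite lt_min e0 d0.
move=> h /andP[h0]; rewrite le_min => /andP[he' hd'] l'.
rewrite in_cons => /orP[/eqP->|]; first by apply: hd; rewrite h0.
by apply: he; rewrite h0.
Qed.

Lemma pairing_self_gt0 b : b != 0 -> 0 < pairing (b : coweightspace R I) b.
Proof.
move=> b0; rewrite lt_neqAle sumr_ge0 ?andbT => [|i _]; last exact: sqr_ge0.
apply: contraNneq b0 => /esym h; apply/eqP/ffunP => i; rewrite ffunE.
have /psumr_eq0P /(_ h i isT) /eqP : forall i, true -> 0 <= b i * b i.
  by move=> j _; exact: sqr_ge0.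
by rewrite mulf_eq0 orbb => /eqP.
Qed.

Lemma generic_point L D x : (forall l, l \in L -> 0 < pairing x l) ->
  (forall d, d \in D -> d != 0) ->
  exists x', (forall l, l \in L -> 0 < pairing x' l) /\
    forall d, d \in D -> pairing x' d != 0.
Proof.
move=> xL; elim: D => [|d D IH] hD; first by exists x.
have [d' d'D|x' [x'L x'D]] := IH; first by apply: hD; rewrite in_cons d'D orbT.
have [e|xd] := eqVneq (pairing x' d) 0; last first.
  by exists x'; split=> // d'; rewrite in_cons => /orP[/eqP->//|/x'D].
have d0 := hD d (mem_head _ _).
(* Multiplying each d' by the sign of its value turns non-vanishing into positivity, so one small
   move along d preserves both kinds of condition. *)
pose sL := L ++ [seq Num.sg (pairing x' d') *: d' | d' <- D].
have [|eps e0 /(_ eps)] := @lex_positive_perturb sL x' d.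
  move=> l; rewrite mem_cat => /orP[/x'L|/mapP[d' d'D ->]]; first by left.
  left; rewrite pairingZr -normrEsg normr_gt0; exact: x'D.
rewrite e0 lexx => /(_ isT) h; exists (x' + eps *: d); split=> [l lL|d'].
  by apply: h; rewrite mem_cat lL.
rewrite in_cons => /orP[/eqP->|d'D].
  by rewrite pairingDl pairingZl e add0r mulf_neq0 ?gt_eqF // pairing_self_gt0.
have : 0 < pairing (x' + eps *: d) (Num.sg (pairing x' d') *: d').
  by apply: h; rewrite mem_cat; apply/orP; right; apply/mapP; exists d'.
by rewrite pairingZr; apply: contraTneq => ->; rewrite mulr0 ltxx.
Qed.

Lemma seq_argmin (T : eqType) (f : T -> R) (s : seq T) t0 : t0 \in s ->
  exists2 t, t \in s & forall u, u \in s -> f t <= f u.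
Proof.
elim: s t0 => // t s IH t0 _; case: s IH => [|t1 s] IH.
  by exists t => [|u]; rewrite ?mem_head // inE => /eqP->.
have [t2 t2s ht2] := IH t1 (mem_head _ _).
have [h|/ltW h] := leP (f t) (f t2).
  exists t; first exact: mem_head.
  move=> u; rewrite in_cons => /orP[/eqP->//|/ht2]; exact: le_trans.
exists t2; first by rewrite in_cons t2s orbT.
by move=> u; rewrite in_cons => /orP[/eqP->|/ht2].
Qed.

(* Follow the ray x + t rho until it first meets a wall; for generic x all the
   functionals vanishing there are proportional. *)
Lemma first_wall L x : (forall l, l \in L -> 0 < pairing x l) ->
  (exists2 b, b \in L & pairing rho b < 0) ->
  exists x' y b, [/\ forall l, l \in L -> 0 < pairing x' l,
    b \in L, pairing rho b < 0, pairing y b = 0 &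
    forall l, l \in L -> 0 < pairing y l \/
      (pairing y l = 0 /\ exists2 c, 0 < c & l = c *: b)].
Proof.
move=> xL [b0 b0L rb0].
(* The ray in direction rho meets the walls of b and l at the same time only if its origin
   annihilates this combination of b and l; off these hyperplanes simultaneous walls are
   proportional. *)
pose D := [seq d <- [seq pairing rho p.1 *: p.2 - pairing rho p.2 *: p.1 |
  p <- [seq (b, l) | b <- L, l <- L]] | d != 0].
have [d|x' [x'L x'D]] := @generic_point L D x xL.
  by rewrite mem_filter => /andP[].
have gen b l : b \in L -> l \in L ->
    pairing rho b * pairing x' l = pairing rho l * pairing x' b ->
    pairing rho b *: l = pairing rho l *: b.
  move=> bL lL h; apply/eqP; rewrite -subr_eq0; apply/negPn/negP => dn0.
  have /x'D : pairing rho b *: l - pairing rho l *: b \in D.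
    rewrite mem_filter dn0; apply/mapP; exists (b, l) => //.
    by apply/allpairsP; exists (b, l).
  by rewrite pairingDr pairingNr !pairingZr h subrr eqxx.
(* The time at which the ray from x' meets the wall of b. *)
pose f b := pairing x' b / - pairing rho b.
have b0N : b0 \in [seq b <- L | pairing rho b < 0] by rewrite mem_filter rb0.
have [b] := seq_argmin f b0N; rewrite mem_filter => /andP[rb bL] hmin.
exists x', (x' + f b *: rho), b; split=> //.
  by rewrite pairingDl pairingZl /f; field; lra.
have fb0 : 0 < f b by rewrite /f divr_gt0 ?x'L // oppr_gt0.
move=> l lL; rewrite pairingDl pairingZl; have x'l := x'L _ lL.
have [rl|rl] := leP 0 (pairing rho l).
  by left; rewrite ltr_wpDr // mulr_ge0 // ltW.
have /hmin : l \in [seq b <- L | pairing rho b < 0] by rewrite mem_filter rl.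
rewrite [f l]/f le_eqVlt ltr_pdivlMr ?oppr_gt0 // => /orP[/eqP h|h]; last first.
  by left; lra.
have hx : f b * - pairing rho l = pairing x' l.
  by rewrite h mulfVK // oppr_eq0 lt_eqF.
right; split; first by lra.
exists (pairing rho l / pairing rho b); first by rewrite nmulr_rgt0 ?invr_lt0.
apply: (scalerI (a := pairing rho b)); first by rewrite lt_eqF.
rewrite scalerA mulrC mulfVK ?lt_eqF //; apply: gen => //.
by rewrite -hx /f; field; lra.
Qed.

End GenericPoints.

(** * Induction along arrows and uniqueness of the cone around an interior point *)

Section Descent.
Variables (R : realType) (I : finType) (B : I -> I -> int) (delta : I -> R).
Hypothesis HB : skew_symmetrized_by B delta.
Variable Fr : framework B delta.
Hypothesis desc : descending Fr.
Local Notation G := (graph Fr).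
Local Notation rho := (rho R I).
Implicit Types (v w u : vertex G) (e g h : edge G) (E : I -> edge G) (S : seed I).
Implicit Types (x y : coweightspace R I).

(** Choosing, below each vertex that violates P, a further one would build an infinite directed
    path. *)
Lemma arrow_ind (P : vertex G -> Prop) :
  (forall v, (forall w, arrow v w -> P w) -> P v) -> forall v, P v.
Proof.
move=> hP v; apply: contrapT => nPv; case: desc => _ _; apply.
have hs (z : {w | ~ P w}) : exists z' : {w | ~ P w}, arrow (sval z) (sval z').
  apply: contrapT => nz; case: z nz => w nw /= nz; apply: nw; apply: hP => w' ww'.
  by apply: contrapT => nw'; apply: nz; exists (exist _ w' nw').
have [f hf] := boolp.choice hs.
by exists (fun i => sval (iter i f (exist _ v nPv))) => i; exact: hf.
Qed.

Lemma negative_arrow v e : incident v e -> pairing rho (lab v e) < 0 ->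
  exists2 w, joins e v w & arrow v w.
Proof.
move=> ve re; have [s1 s2] := incident_sgn ve.
have [w jw] : exists w, joins e v w.
  apply: full_edge_joins => // he; case: desc => _ /(_ _ _ ve he) /s1 h _.
  by move: (lt_trans re h); rewrite ltxx.
by exists w => //; exists e; split=> //; apply/s2.
Qed.

Lemma no_negative_base v :
  (forall e, incident v e -> 0 < pairing rho (lab v e)) -> v = base Fr.
Proof.
case: desc => h _ _ hv; apply: h => e ve; apply/(incident_sgn ve).1.
exact: hv.
Qed.

(* With [up] set, only walls leading away from the base may be crossed. *)
Inductive reach (up : bool) : vertex G -> (I -> edge G) -> seed I -> Prop :=
| reach_base E : base_marking E -> reach up (base Fr) E (initial_seed B)
| reach_step v E S w k : reach up v E S -> joins (E k) v w ->
    (up -> 0 < pairing rho (lab v (E k))) ->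
    reach up w (transport v w (E k) E) (mutate k S).

Lemma reach_marked up v E S : reach up v E S -> marked v E S.
Proof.
elim=> [{}E hE|{}v {}E {}S w k _ IH jw _]; first exact: base_marked.
exact: (transport_marked HB IH jw).1.
Qed.

Lemma reach_up_exists v : exists E S, reach true v E S.
Proof.
elim/arrow_ind: v => v IH.
have [hv|] := pselect (forall e, incident v e -> 0 < pairing rho (lab v e)).
  rewrite (no_negative_base hv); have [E hE] := base_marking_exists Fr.
  by exists E, (initial_seed B); constructor.
move=> /existsNP[e /not_implyP[ve /negP re]].
have {}re : pairing rho (lab v e) < 0.
  by rewrite lt_neqAle incident_rho_neq0 //= leNgt.
have [w jw /IH [E [S rS]]] := negative_arrow ve re.
have jw' := joinsC jw.
have [k kE] := marked_surj (reach_marked rS) (joins_incl jw'); subst e.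
exists (transport w v (E k) E), (mutate k S); apply: reach_step => // _.
by rewrite (lab_opp jw).1 pairingNr oppr_gt0.
Qed.

Lemma marking_exists v : exists E S, marked v E S.
Proof.
have [E [S /reach_marked]] := reach_up_exists v; by exists E, S.
Qed.

Lemma lab_proportional v e g c : incident v e -> incident v g -> 
  lab v g = c *: lab v e -> g = e.
Proof.
have [E [S mS]] := marking_exists v; have [d [dE _]] := marked_dual mS.
move=> /(marked_surj mS)[i <-] /(marked_surj mS)[j <-] h.
have := dE j j; rewrite h pairingZr dE eqxx.
by case: eqVneq => [->//|_]; rewrite mulr0 => /esym/eqP; rewrite oner_eq0.
Qed.

Lemma labels_finite v : exists L : seq (rootspace R I),
  forall l, l \in L <-> exists2 e, incident v e & l = lab v e.
Proof.
have [E [S mS]] := marking_exists v.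
exists [seq lab v (E i) | i <- enum I] => l; split.
  by move=> /mapP[i _ ->]; exists (E i) => //; exact: marked_inc mS i.
move=> [e /(marked_surj mS)[i <-] ->]; apply: map_f; exact: mem_enum.
Qed.

Lemma coneP v x : cone v x <-> forall e, incident v e -> 0 <= pairing x (lab v e).
Proof.
by split=> h e ve; move: (h e ve); have [c [c0 ->]] := colab_multiple ve;
  rewrite pairingZr pmulr_rge0.
Qed.

(** Mutation adds multiples of [lab v e], so on the wall of e both vertices carry the same
    functionals. *)
Lemma label_across v w e : joins e v w -> forall h, incident w h ->
  exists g, [/\ incident v g, h = e <-> g = e &
    forall x, pairing x (lab v e) = 0 -> pairing x (lab w h) = pairing x (lab v g)].
Proof.
move=> jw h wh; have [E [S mS]] := marking_exists v.
have [k kE] := marked_surj mS (joins_incl jw); subst e.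
have [mS' labE] := transport_marked HB mS jw.
have [i iE] := marked_surj mS' wh; subst h; exists (E i); split.
- exact: marked_inc mS i.
- have Ek : transport v w (E k) E k = E k.
    by rewrite /transport /edge_transport asboolT.
  by rewrite -{2}Ek; split=> [/(marked_inj mS')|/(marked_inj mS)] ->.
- move=> x xk; rewrite labE; case: eqP => [->|_]; first by rewrite pairingNr xk oppr0.
  by rewrite pairingDr pairingZr xk mulr0 addr0.
Qed.

Definition interior_point v x := forall e, incident v e -> 0 < pairing x (lab v e).

Definition lex_interior v x := forall e, incident v e -> lex_positive x rho (lab v e).

(** At y only the label of e vanishes, and crossing reverses its sign, so rho points inwards on the
    far side. *)
Lemma cross_wall v w e y : joins e v w -> pairing rho (lab v e) < 0 ->
  pairing y (lab v e) = 0 ->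
  (forall g, incident v g -> g <> e -> 0 < pairing y (lab v g)) ->
  lex_interior w y.
Proof.
move=> jw re ye yg h wh; have [g [vg hg hE]] := label_across jw wh.
have [he|he] := pselect (h = e); last first.
  by left; rewrite hE //; apply: yg => // /hg.
by right; rewrite he (lab_opp jw).1 !pairingNr ye oppr0 oppr_gt0.
Qed.

Lemma lex_interior_common v w y : lex_interior v y -> lex_interior w y ->
  exists x, interior_point v x /\ interior_point w x.
Proof.
move=> vy wy; have [Lv hLv] := labels_finite v; have [Lw hLw] := labels_finite w.
have [l|eps e0 /(_ eps)] := @lex_positive_perturb _ _ (Lv ++ Lw) y rho.
  by rewrite mem_cat => /orP[/hLv[e ve ->]|/hLw[e we ->]]; [exact: vy|exact: wy].
rewrite e0 lexx => /(_ isT) hx; exists (y + eps *: rho).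
by split=> e he; apply: hx; rewrite mem_cat; apply/orP; [left; apply/hLv|right; apply/hLw];
  exists e.
Qed.

Lemma interior_disjoint v w x : interior_point v x -> interior_point w x -> v = w.
Proof.
(* Nested induction: the step may lower v with w arbitrary, or lower w with v fixed. *)
elim/arrow_ind: v w x => v IHv w; elim/arrow_ind: w => w IHw x0 vx0 wx0.
have [Lv hLv] := labels_finite v; have [Lw hLw] := labels_finite w.
have Lpos x : (forall l, l \in Lv ++ Lw -> 0 < pairing x l) ->
    interior_point v x /\ interior_point w x.
  by move=> h; split=> e he; apply: h; rewrite mem_cat; apply/orP;
    [left; apply/hLv|right; apply/hLw]; exists e.
have [neg|nneg] := pselect (exists2 b, b \in Lv ++ Lw & pairing rho b < 0); last first.
  have pos l : l \in Lv ++ Lw -> pairing rho l != 0 -> 0 < pairing rho l.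
    by move=> hl l0; rewrite lt_neqAle eq_sym l0 leNgt; apply/negP => ?; apply: nneg; exists l.
  have -> : v = base Fr.
    apply: no_negative_base => e he; apply: pos; rewrite ?incident_rho_neq0 //.
    by rewrite mem_cat; apply/orP; left; apply/hLv; exists e.
  apply/esym/no_negative_base => e he; apply: pos; rewrite ?incident_rho_neq0 //.
  by rewrite mem_cat; apply/orP; right; apply/hLw; exists e.
have [l|x [y [b [xL bL rb yb hL]]]] := first_wall (x := x0) _ neg.
  by rewrite mem_cat => /orP[/hLv[e ve ->]|/hLw[e we ->]]; [exact: vx0|exact: wx0].
have [vx wx] := Lpos _ xL.
have inL e : (incident v e -> lab v e \in Lv ++ Lw) /\ (incident w e -> lab w e \in Lv ++ Lw).
  by split=> he; rewrite mem_cat; apply/orP; [left; apply/hLv|right; apply/hLw]; exists e.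
have cross z e : incident z e -> (forall g, incident z g -> lab z g \in Lv ++ Lw) ->
    pairing y (lab z e) = 0 -> exists2 z', joins e z z' & arrow z z' /\ lex_interior z' y.
  move=> ze zL yze.
  have prop g : incident z g -> 0 < pairing y (lab z g) \/ (exists2 c, 0 < c & lab z g = c *: b).
    by move=> /zL /hL [|[_]]; [left|right].
  have [|[c c0 eE]] := prop _ ze; first by rewrite yze ltxx.
  have re : pairing rho (lab z e) < 0 by rewrite eE pairingZr pmulr_rlt0.
  have [z' jz' zz'] := negative_arrow ze re; exists z' => //; split=> //.
  apply: cross_wall jz' re yze _ => g zg ge; have [//|[c' c'0 gE]] := prop _ zg.
  case: ge; apply: (@lab_proportional z e g (c' / c)) => //.
  by rewrite gE eE scalerA mulfVK // gt_eqF.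
have vL e : incident v e -> lab v e \in Lv ++ Lw by case: (inL e).
have wL e : incident w e -> lab w e \in Lv ++ Lw by case: (inL e).
have lexy z : (forall e, incident z e -> lab z e \in Lv ++ Lw) ->
    ~ (exists2 e, incident z e & pairing y (lab z e) = 0) -> lex_interior z y.
  move=> zL nz e ze; have [|[h _]] := hL _ (zL _ ze); first by left.
  by case: nz; exists e.
(* If y lies on walls of both cones, the far sides coincide by induction and the two walls are one
   edge of that vertex, so v = w. If y lies on a wall of only one cone, the far side is the other
   vertex; then opposite labels of the crossed edge would both be positive at x. *)
have [[e ve ye]|nv] := pselect (exists2 e, incident v e & pairing y (lab v e) = 0).
  have [v' jv [vv' ly]] := cross v e ve vL ye.
  have [[f wf yf]|nw] := pselect (exists2 e, incident w e & pairing y (lab w e) = 0).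
    have [w' jw [ww' ly']] := cross w f wf wL yf.
    have [x' [v'x w'x]] := lex_interior_common ly ly'.
    have e1 := IHv _ vv' _ _ v'x w'x; subst w'.
    have ef : f = e.
      have [|[_ [c c0 eE]]] := hL _ (vL _ ve); first by rewrite ye ltxx.
      have [|[_ [c' c'0 fE]]] := hL _ (wL _ wf); first by rewrite yf ltxx.
      apply: (@lab_proportional v' e f (c' / c)).
      - exact: joins_incl (joinsC jv).
      - exact: joins_incl (joinsC jw).
      rewrite (lab_opp jv).1 (lab_opp jw).1 eE fE scalerN scalerA mulfVK //.
      by rewrite gt_eqF.
    by subst f; exact: joins_inj (joinsC jv) (joinsC jw).
  have [x' [v'x w'x]] := lex_interior_common ly (lexy _ wL nw).
  have e1 := IHv _ vv' _ _ v'x w'x; subst v'.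
  have := wx _ (joins_incl (joinsC jv)); rewrite (lab_opp jv).1 pairingNr.
  by rewrite oppr_gt0 => /(lt_trans (vx _ ve)); rewrite ltxx.
have [f wf yf] : exists2 e, incident w e & pairing y (lab w e) = 0.
  move: bL; rewrite mem_cat => /orP[/hLv[e ve bE]|/hLw[e we bE]].
    by case: nv; exists e; rewrite -?bE.
  by exists e; rewrite -?bE.
have [w' jw [ww' ly']] := cross w f wf wL yf.
have [x' [v'x w'x]] := lex_interior_common (lexy _ vL nv) ly'.
have e1 := IHw _ ww' _ v'x w'x; subst w'.
have := vx _ (joins_incl (joinsC jw)); rewrite (lab_opp jw).1 pairingNr.
by rewrite oppr_gt0 => /(lt_trans (wx _ wf)); rewrite ltxx.
Qed.

End Descent.

(** * The fan of cones *)

Section Fan.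
Variables (R : realType) (I : finType) (B : I -> I -> int) (delta : I -> R).
Hypothesis HB : skew_symmetrized_by B delta.
Variable Fr : framework B delta.
Hypothesis desc : descending Fr.
Local Notation G := (graph Fr).
Local Notation rho := (rho R I).
Implicit Types (v w u : vertex G) (e g h : edge G) (E : I -> edge G) (S : seed I).
Implicit Types (x y z : coweightspace R I).

(** For x in [cone v], the smallest face of [cone v] containing x. *)
Definition minface v x : set (coweightspace R I) := [set y | cone v y /\
  forall e, incident v e -> pairing x (lab v e) = 0 -> pairing y (lab v e) = 0].

Inductive star_desc x : vertex G -> vertex G -> Prop :=
| star_desc_refl v : star_desc x v v
| star_desc_step v w u e : joins e v w -> pairing x (lab v e) = 0 ->
    pairing rho (lab v e) < 0 -> star_desc x w u -> star_desc x v u.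

Lemma cone_step v w e x : joins e v w -> pairing x (lab v e) = 0 ->
  cone v x -> cone w x.
Proof.
move=> jw xe /coneP vx; apply/coneP => h wh.
by have [g [vg _ ->//]] := label_across HB desc jw wh; exact: vx.
Qed.

Lemma minface_step v w e x : joins e v w -> pairing x (lab v e) = 0 ->
  minface v x = minface w x.
Proof.
have sub v' w' : joins e v' w' -> pairing x (lab v' e) = 0 ->
    minface v' x `<=` minface w' x.
  move=> jw xe y [vy yx]; have ye := yx _ (joins_incl jw) xe.
  split=> [|h wh]; first exact: cone_step jw ye vy.
  have [g [vg _ gE]] := label_across HB desc jw wh.
  by rewrite !gE //; exact: yx.
move=> jw xe; apply/seteqP; split; first exact: sub.
by apply: sub (joinsC jw) _; rewrite (lab_opp jw).1 pairingNr xe oppr0.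
Qed.

Lemma star_desc_exists v x : cone v x ->
  exists2 u, star_desc x v u & lex_interior u x.
Proof.
elim/(arrow_ind desc): v => v IH vx.
have [lx|nlx] := pselect (lex_interior v x).
  by exists v => //; constructor.
have [e [ve xe re]] : exists e, [/\ incident v e, pairing x (lab v e) = 0 &
    pairing rho (lab v e) < 0].
  apply: contrapT => ne; apply: nlx => e ve.
  have := (coneP v x).1 vx e ve; rewrite le_eqVlt => /orP[/eqP/esym xe|]; last by left.
  right; split=> //; rewrite lt_neqAle eq_sym incident_rho_neq0 // leNgt.
  by apply/negP => re; apply: ne; exists e.
have [w jw vw] := negative_arrow desc ve re.
have [u wu lu] := IH _ vw (cone_step jw xe vx).
by exists u => //; apply: star_desc_step jw xe re wu.
Qed.

Lemma lex_interior_unique u u' x : lex_interior u x -> lex_interior u' x -> u = u'.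
Proof.
move=> ux u'x; have [y [uy u'y]] := lex_interior_common HB desc ux u'x.
exact: (interior_disjoint HB desc uy u'y).
Qed.

Definition linked (P : vertex G -> Prop) v w := exists k p,
  is_path k p v w /\ forall i, (i <= k)%N -> P (p i).

Lemma linked_refl (P : vertex G -> Prop) v : P v -> linked P v v.
Proof. by move=> Pv; exists 0%N, (fun=> v). Qed.

Lemma linked_cons (P : vertex G -> Prop) v w u e :
  P v -> joins e v w -> linked P w u -> linked P v u.
Proof.
move=> Pv jw [k [p [[p0 pk pj] pP]]].
exists k.+1, (fun i => if i is j.+1 then p j else v); split; last by case.
by split=> //; case=> [|i] ik; [exists e; rewrite p0|exact: pj].
Qed.

Lemma linked_rcons (P : vertex G -> Prop) v w u e :
  linked P v w -> joins e w u -> P u -> linked P v u.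
Proof.
move=> [k [p [[p0 pk pj] pP]]] jw Pu.
exists k.+1, (fun i => if (i <= k)%N then p i else u); split; last first.
  by move=> i _; case: leqP => // ik; exact: pP.
split; rewrite ?ltnn // => i; rewrite ltnS => ik; rewrite ik.
have [ik'|ki] := ltnP i k; first exact: pj.
by have -> : i = k by [lia]; exists e; rewrite pk.
Qed.

Lemma star_connected v w x : cone v x -> cone w x ->
  minface v x = minface w x /\ linked (fun u => minface u x = minface v x) v w.
Proof.
move=> vx wx; have [u vu lu] := star_desc_exists vx.
have [u' wu' lu'] := star_desc_exists wx.
have e := lex_interior_unique lu lu'; subst u'.
have eqf a b : star_desc x a b -> minface a x = minface b x.
  by elim=> // {}a c {}b e jc xe _ _ <-; exact: minface_step jc xe.
have vw : minface v x = minface w x by rewrite (eqf _ _ vu) (eqf _ _ wu').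
have lvu a b F : star_desc x a b -> minface a x = F ->
    linked (fun u => minface u x = F) a b.
  elim=> [{}a aF|{}a c {}b e jc xe _ _ IH aF]; first exact: linked_refl.
  have cF : minface c x = F by rewrite -(minface_step jc xe).
  exact: linked_cons aF jc (IH cF).
split=> //; move/lvu: vu => /(_ _ erefl) {}lvu.
have : minface w x = minface v x by rewrite vw.
elim: wu' lvu => // w1 w2 u1 e j1 xe _ wu IH lvu hw.
have hw2 : minface w2 x = minface v x by rewrite -(minface_step j1 xe).
exact: linked_rcons (IH lvu hw2) (joinsC j1) hw.
Qed.

Lemma minfaceP v E S x y : marked v E S -> minface v x y <->
  forall i, 0 <= pairing y (lab v (E i)) /\
    (pairing x (lab v (E i)) = 0 -> pairing y (lab v (E i)) = 0).
Proof.
move=> mS; split=> [[/coneP vy yx] i|h].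
  by have vi := marked_inc mS i; split; [exact: vy|exact: yx].
split=> [|e /(marked_surj mS)[i <-]]; last by case: (h i).
by apply/coneP => e /(marked_surj mS)[i <-]; case: (h i).
Qed.

Lemma interior_exists v : exists x, interior_point v x.
Proof.
have [E [S mS]] := marking_exists HB desc v; have [g [gE _]] := marked_dual mS.
exists (\sum_i g i) => e /(marked_surj mS)[j <-].
rewrite pairing_suml (bigD1 j) //= gE eqxx big1 ?addr0 // => i /negPf ij.
by rewrite gE ij.
Qed.

(** Lets the lemmas about [minface] speak of whole cones as well as of their faces. *)
Lemma minface_interior v x : interior_point v x -> minface v x = cone v.
Proof.
move=> vx; apply/seteqP; split=> y; first by case.
by move=> vy; split=> // e ve xe; move: (vx e ve); rewrite xe ltxx.
Qed.

Lemma minface_refl v x : cone v x -> minface v x x.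
Proof. by []. Qed.

(** The cones are simplicial: [minface v x] is generated by the dual vectors whose label is nonzero
    at x, and its face cut out by a by those on which a also vanishes. Their sum is the point x'. *)
Lemma face_of_minface v x F : is_face F (minface v x) ->
  exists2 x', cone v x' & F = minface v x'.
Proof.
move=> [a [a0 ->]]; have [E [S mS]] := marking_exists HB desc v.
have [g [gE xE]] := marked_dual mS.
pose J i := (pairing x (lab v (E i)) != 0) && (pairing (g i) a == 0).
pose x' := \sum_(i | J i) g i.
have x'E i : pairing x' (lab v (E i)) = (J i)%:R.
  rewrite pairing_suml; case: (boolP (J i)) => Ji; last first.
    by rewrite big1 // => j Jj; rewrite gE; case: eqP Jj Ji => // -> ->.
  rewrite (bigD1 i) //= gE eqxx big1 ?addr0 // => j /andP[_ /negPf ji].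
  by rewrite gE ji.
have ga i : pairing x (lab v (E i)) != 0 -> 0 <= pairing (g i) a.
  move=> xi; apply: a0; apply/(minfaceP _ _ mS) => j; rewrite gE ler0n; split=> //.
  by move=> xj; case: (eqVneq i j) => // ij; move: xi; rewrite ij xj eqxx.
have yaE y : pairing y a = \sum_i pairing y (lab v (E i)) * pairing (g i) a.
  by rewrite {1}[y]xE pairing_suml; apply: eq_bigr => i _; rewrite pairingZl.
exists x'; first by apply/coneP => e /(marked_surj mS)[i <-]; rewrite x'E ler0n.
apply/seteqP; split=> y /=.
  move=> [/(minfaceP _ _ mS) yP]; rewrite yaE => /psumr_eq0P h.
  apply/(minfaceP _ _ mS) => i; have [yi0 yi] := yP i; split=> //.
  rewrite x'E /J; have [xi|xi] := eqVneq (pairing x (lab v (E i))) 0.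
    by move=> _; exact: yi.
  case: eqVneq => [_ /= /eqP|gia _]; first by rewrite oner_eq0.
  have /eqP : pairing y (lab v (E i)) * pairing (g i) a = 0.
    apply: h => // j _; have [yj0 yj] := yP j.
    have [xj|xj] := eqVneq (pairing x (lab v (E j))) 0; first by rewrite yj // mul0r.
    by rewrite mulr_ge0 // ga.
  by rewrite mulf_eq0 (negPf gia) orbF => /eqP.
move=> /(minfaceP _ _ mS) yP; split.
  apply/(minfaceP _ _ mS) => i; have [yi0 yi] := yP i; split=> // xi.
  by apply: yi; rewrite x'E /J xi eqxx.
rewrite yaE big1 // => i _; have [gia|gia] := eqVneq (pairing (g i) a) 0.
  by rewrite gia mulr0.
by rewrite (yP i).2 ?mul0r // x'E /J (negPf gia) andbF.
Qed.

Lemma minface_is_face v x z : minface v x z ->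
  is_face (minface v z) (minface v x).
Proof.
have [E [S mS]] := marking_exists HB desc v => /(minfaceP _ _ mS) zP.
(* A sum of nonnegative terms vanishes only where every label that is zero at z vanishes. *)
exists (\sum_(i | pairing z (lab v (E i)) == 0) lab v (E i)); split.
  move=> y /(minfaceP _ _ mS) yP; rewrite pairing_sumr; apply: sumr_ge0 => i _.
  by case: (yP i).
apply/seteqP; split=> y /=.
  move=> /(minfaceP _ _ mS) yP; split.
    apply/(minfaceP _ _ mS) => i; have [yi0 yi] := yP i; split=> // xi.
    by apply: yi; apply: (zP i).2.
  by rewrite pairing_sumr big1 // => i /eqP; case: (yP i).
move=> [/(minfaceP _ _ mS) yP]; rewrite pairing_sumr => /psumr_eq0P h.
apply/(minfaceP _ _ mS) => i; have [yi0 _] := yP i; split=> // /eqP zi.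
by apply: h => // j _; case: (yP j).
Qed.

Lemma minface_polyhedral v x : polyhedral_cone (minface v x).
Proof.
have [E [S mS]] := marking_exists HB desc v.
exists ([seq lab v (E i) | i <- enum I] ++
  [seq - lab v (E i) | i <- enum I & pairing x (lab v (E i)) == 0]).
apply/seteqP; split=> y /=.
  move=> /(minfaceP _ _ mS) yP a; rewrite mem_cat => /orP[] /mapP[i]; last first.
    by rewrite mem_filter => /andP[/eqP xi _] ->; rewrite pairingNr (yP i).2 ?oppr0.
  by move=> _ ->; case: (yP i).
move=> yP; apply/(minfaceP _ _ mS) => i.
have yi0 : 0 <= pairing y (lab v (E i)).
  by apply: yP; rewrite mem_cat map_f // mem_enum.
split=> // xi; apply: le_anti; rewrite yi0 andbT -oppr_ge0 -pairingNr.
apply: yP; rewrite mem_cat; apply/orP; right; apply/mapP; exists i => //.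
by rewrite mem_filter xi eqxx mem_enum.
Qed.

Lemma minfaceD v x y z : minface v x y -> minface v x z -> minface v x (y + z).
Proof.
have [E [S mS]] := marking_exists HB desc v.
move=> /(minfaceP _ _ mS) yP /(minfaceP _ _ mS) zP; apply/(minfaceP _ _ mS) => i.
have [y0 yi] := yP i; have [z0 zi] := zP i; rewrite pairingDl addr_ge0 //.
by split=> // xi; rewrite yi // zi // addr0.
Qed.

Lemma minface0 v x : minface v x 0.
Proof.
have [E [S mS]] := marking_exists HB desc v.
by apply/(minfaceP _ _ mS) => i; rewrite pairing0l.
Qed.

(** The point z is chosen as generic as the intersection allows: each label at v that is nonzero
    somewhere on it is nonzero at z. This puts the intersection inside [minface v z]. For the
    converse, z lies in both cones, so by [star_connected] its minimal face is the same at v and at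
    w. *)
Lemma minfaceI v w x y : exists z, [/\ minface v x z, minface w y z &
  minface v x `&` minface w y = minface v z].
Proof.
have [E [S mS]] := marking_exists HB desc v.
pose M := minface v x `&` minface w y.
have MD a b : M a -> M b -> M (a + b).
  by move=> [a1 a2] [b1 b2]; split; apply: minfaceD.
have M0 : M 0 by split; apply: minface0.
have /boolp.choice[f fP] : forall i, exists s, M s /\
    (forall t, M t -> pairing t (lab v (E i)) != 0 ->
       pairing s (lab v (E i)) != 0).
  move=> i.
  have [[t Mt ti]|nt] := pselect (exists2 t, M t & pairing t (lab v (E i)) != 0).
    by exists t.
  by exists 0; split=> // t Mt ti; case: nt; exists t.
have Mf : M (\sum_i f i).
  by apply: (big_ind M) => // i _; case: (fP i).
have [Mf1 Mf2] := Mf; exists (\sum_i f i); split=> //.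
apply/seteqP; split=> t; last first.
  have vf : cone v (\sum_i f i) by case: Mf1.
  have wf : cone w (\sum_i f i) by case: Mf2.
  move=> tf; have [tE _] := star_connected vf wf; split.
    move: tf => /(minfaceP _ _ mS) tf; move/(minfaceP _ _ mS): Mf1 => zP.
    apply/(minfaceP _ _ mS) => i; have [t0 ti] := tf i; split=> // xi.
    by apply: ti; exact: (zP i).2.
  move: tf; rewrite tE; have [E' [S' mS']] := marking_exists HB desc w.
  move=> /(minfaceP _ _ mS') tf; move/(minfaceP _ _ mS'): Mf2 => zP.
  apply/(minfaceP _ _ mS') => i; have [t0 ti] := tf i; split=> // xi.
  by apply: ti; exact: (zP i).2.
move=> Mt; have [[vt _] _] := Mt; split=> // e /(marked_surj mS)[i <-].
rewrite pairing_suml => h; apply/eqP/negPn/negP => ti.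
have := (fP i).2 t Mt ti; rewrite (psumr_eq0P _ h) ?eqxx // => j _.
by case: (fP j) => -[[/coneP hj _] _] _; apply: hj; exact: marked_inc mS i.
Qed.

(** Moving an interior point of the smaller cone slightly towards the interior of the larger one
    reaches a point interior to both. *)
Lemma cone_subset v w : cone v `<=` cone w -> v = w.
Proof.
move=> vw; have [x vx] := interior_exists v; have [q wq] := interior_exists w.
have [Lv hLv] := labels_finite HB desc v.
have [l|eps e0 /(_ eps)] := @lex_positive_perturb _ _ Lv x q.
  by move=> /hLv[e ve ->]; left; exact: vx.
rewrite e0 lexx => /(_ isT) hx.
apply: (interior_disjoint HB desc (x := x + eps *: q)) => e he.
  by apply: hx; apply/hLv; exists e.
have /coneP wx : cone w x by apply: vw; apply/coneP => f vf; exact/ltW/vx.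
by rewrite pairingDl pairingZl ltr_wpDl ?wx // mulr_gt0 // wq.
Qed.

Lemma descending_polyhedral : polyhedral Fr.
Proof.
have faceE v F : is_face F (cone v) -> exists2 x, cone v x & F = minface v x.
  have [q vq] := interior_exists v; rewrite -(minface_interior vq).
  by move=> /face_of_minface; rewrite minface_interior.
have minface_face v x : cone v x -> is_face (minface v x) (cone v).
  have [q vq] := interior_exists v; rewrite -(minface_interior vq).
  exact: minface_is_face.
have cone_face v : is_face (cone v) (cone v).
  have [q vq] := interior_exists v; rewrite -{1}(minface_interior vq).
  by apply: minface_face; apply/coneP => e ve; exact/ltW/vq.
split; last by move=> v w vw; apply: cone_subset; rewrite vw.
exists [set K | exists v, is_face K (cone v)]; split; first split.
- by move=> K [v /faceE[x _ ->]]; exact: minface_polyhedral.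
- move=> K F [v /faceE[x _ ->]] /face_of_minface[x' vx' ->].
  by exists v; exact: minface_face.
- move=> K L [v /faceE[x vx ->]] [w /faceE[y wy ->]].
  have [z [vz wz ->]] := minfaceI v w x y; split; first exact: minface_is_face.
  have [->] : minface v z = minface w z /\ _ := star_connected vz.1 wz.1.
  by move=> _; exact: minface_is_face.
move=> K; split=> [[[v Kv] Kmax]|[v ->]].
  exists v; apply/esym/Kmax; first by exists v.
  by have [a [_ ->]] := Kv; move=> y [].
split; first by exists v.
move=> L [w [a [_ ->]]] vL; have e : v = w by apply: cone_subset => y /vL[].
by subst w; apply/seteqP; split=> // y [].
Qed.

Lemma descending_well_connected : well_connected Fr.
Proof.
move=> v w F; have faceE u : is_face F (cone u) -> exists2 x, cone u x & F = minface u x.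
  have [q uq] := interior_exists u; rewrite -(minface_interior uq).
  by move=> /face_of_minface; rewrite minface_interior.
move=> /faceE[x vx FE] /faceE[y wy FE'].
have wx : cone w x by have := minface_refl vx; rewrite -FE FE' => -[].
have [_ [k [p [vw hp]]]] := star_connected vx wx.
exists k, p; split=> // i ik; rewrite FE -(hp i ik).
have : minface (p i) x x by rewrite (hp i ik); exact: minface_refl.
have [q uq] := interior_exists (p i); rewrite -(minface_interior uq).
by case=> + _; rewrite -(minface_interior uq); exact: minface_is_face.
Qed.

Lemma descending_injective : injective_framework Fr.
Proof.
move=> u v; have [_ cone_inj] := descending_polyhedral; split; split=> [h|->//];
  apply: cone_inj; apply/seteqP; split=> x.
- move=> /coneP ux; apply/coneP => e ve.
  have : (lab v @` incident v) (lab v e) by exists e.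
  by rewrite -h => -[f uf <-]; exact: ux.
- move=> /coneP vx; apply/coneP => e ue.
  have : (lab u @` incident u) (lab u e) by exists e.
  by rewrite h => -[f vf <-]; exact: vx.
- move=> ux e ve; have : (colab v @` incident v) (colab v e) by exists e.
  by rewrite -h => -[f uf <-]; exact: ux.
- move=> vx e ue; have : (colab u @` incident u) (colab u e) by exists e.
  by rewrite h => -[f vf <-]; exact: vx.
Qed.

End Fan.

(** * The rank-two exchange recurrence *)

Section RankTwoFieldIdentities.
Variable K : fieldType.
Implicit Types (p q : K).

(* In each case p and q are the two coefficient monomials of the middle cluster,
   from which all other cluster variables are expressed. *)
Lemma rank2_core11 p q w0 w1 w2 w3 w4 w5 : q != 0 ->
  w1 != 0 -> w2 != 0 -> w3 != 0 ->
  w0 * w2 = q^-1 + w1 -> w1 * w3 = p + w2 -> w2 * w4 = p * q + w3 ->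
  w3 * w5 = q + w4 -> w5 = w0 * q.
Proof.
move=> q0 n1 n2 n3 e0 e1 e2 e3.
have E3 : w3 = (p + w2) / w1 by apply: (mulfI n1); rewrite e1; field.
have E4 : w4 = (p * q + w3) / w2 by apply: (mulfI n2); rewrite e2; field.
have E0 : w0 = (q^-1 + w1) / w2 by apply: (mulIf n2); rewrite e0; field; rewrite ?n2 ?q0.
apply: (mulfI n3); rewrite e3 E4 E0 E3; field.
by rewrite n1 n2 q0.
Qed.

Lemma rank2_core12 p q w0 w1 w2 w3 w4 w5 w6 : p != 0 -> q != 0 ->
  w2 != 0 -> w3 != 0 -> w4 != 0 ->
  w0 * w2 = (p * q ^+ 2)^-1 + w1 ^+ 2 -> w1 * w3 = q^-1 + w2 ->
  w2 * w4 = p + w3 ^+ 2 -> w3 * w5 = p * q + w4 ->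
  w4 * w6 = p * q ^+ 2 + w5 ^+ 2 -> w6 = w0 * (p * q ^+ 2).
Proof.
move=> p0 q0 n2 n3 n4 e0 e1 e2 e3 e4.
have E4 : w4 = (p + w3 ^+ 2) / w2 by apply: (mulfI n2); rewrite e2; field.
have E5 : w5 = (p * q * w2 + p + w3 ^+ 2) / (w2 * w3).
  by apply: (mulfI n3); rewrite e3 E4; field; rewrite n2 n3.
have E1 : w1 = (1 + q * w2) / (q * w3).
  by apply: (mulIf n3); rewrite e1; field; rewrite q0 n3.
have E0 : w0 = (w3 ^+ 2 + p * (1 + q * w2) ^+ 2) / (p * q ^+ 2 * w2 * w3 ^+ 2).
  by apply: (mulIf n2); rewrite e0 E1; field; rewrite p0 q0 n2 n3.
by apply: (mulfI n4); rewrite e4 E5 E0 E4; field; rewrite p0 q0 n2 n3.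
Qed.

Lemma rank2_core21 p q w0 w1 w2 w3 w4 w5 w6 : p != 0 -> q != 0 ->
  w2 != 0 -> w3 != 0 -> w4 != 0 ->
  w0 * w2 = (p * q)^-1 + w1 -> w1 * w3 = q^-1 + w2 ^+ 2 ->
  w2 * w4 = p + w3 -> w3 * w5 = p ^+ 2 * q + w4 ^+ 2 ->
  w4 * w6 = p * q + w5 -> w6 = w0 * (p * q).
Proof.
move=> p0 q0 n2 n3 n4 e0 e1 e2 e3 e4.
have E4 : w4 = (p + w3) / w2 by apply: (mulfI n2); rewrite e2; field.
have E5 : w5 = (p ^+ 2 * q * w2 ^+ 2 + (p + w3) ^+ 2) / (w2 ^+ 2 * w3).
  by apply: (mulfI n3); rewrite e3 E4; field; rewrite n2 n3.
have E1 : w1 = (1 + q * w2 ^+ 2) / (q * w3).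
  by apply: (mulIf n3); rewrite e1; field; rewrite q0 n3.
have E0 : w0 = (w3 + p * (1 + q * w2 ^+ 2)) / (p * q * w2 * w3).
  by apply: (mulIf n2); rewrite e0 E1; field; rewrite p0 q0 n2 n3.
by apply: (mulfI n4); rewrite e4 E5 E0 E4; field; rewrite p0 q0 n2 n3.
Qed.

Lemma rank2_core13 p q w0 w1 w2 w3 w4 w5 w6 w7 w8 : p != 0 -> q != 0 ->
  w2 != 0 -> w3 != 0 -> w4 != 0 -> w5 != 0 -> w6 != 0 ->
  w0 * w2 = (p ^+ 3 * q ^+ 2)^-1 + w1 ^+ 3 -> w1 * w3 = (p * q)^-1 + w2 ->
  w2 * w4 = q^-1 + w3 ^+ 3 ->
  w3 * w5 = p + w4 -> w4 * w6 = p ^+ 3 * q + w5 ^+ 3 ->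
  w5 * w7 = p ^+ 2 * q + w6 -> w6 * w8 = p ^+ 3 * q ^+ 2 + w7 ^+ 3 ->
  w8 = w0 * (p ^+ 3 * q ^+ 2).
Proof.
move=> p0 q0 n2 n3 n4 n5 n6 e0 e1 e2 e3 e4 e5 e6.
have E5 : w5 = (p + w4) / w3 by apply: (mulfI n3); rewrite e3; field.
have E6 : w6 = (p ^+ 3 * q * w3 ^+ 3 + (p + w4) ^+ 3) / (w3 ^+ 3 * w4).
  by apply: (mulfI n4); rewrite e4 E5; field; rewrite n3 n4.
have E7 : w7 = (p ^+ 2 * q * w3 ^+ 3 + (p + w4) ^+ 2) / (w3 ^+ 2 * w4).
  by apply: (mulfI n5); rewrite e5 E6 E5; field; rewrite n3 n4.
have E2 : w2 = (1 + q * w3 ^+ 3) / (q * w4).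
  by apply: (mulIf n4); rewrite e2; field; rewrite q0 n4.
have E1 : w1 = (w4 + p + p * q * w3 ^+ 3) / (p * q * w3 * w4).
  by apply: (mulIf n3); rewrite e1 E2; field; rewrite p0 q0 n3 n4.
(* The numerator of [w0 * w2] is divisible by that of w2, namely [1 + q * w3 ^+ 3]; the quotient is
   written out, leaving a Laurent expression in w3 and w4. *)
have E0 : w0 = (w4 ^+ 3 + 3%:R * w4 ^+ 2 * p +
    3%:R * w4 * p ^+ 2 * (1 + q * w3 ^+ 3) + p ^+ 3 * (1 + q * w3 ^+ 3) ^+ 2) /
    (p ^+ 3 * q ^+ 2 * w3 ^+ 3 * w4 ^+ 2).
  by apply: (mulIf n2); rewrite e0 E1 E2; field; rewrite p0 q0 n3 n4.
by apply: (mulfI n6); rewrite e6 E7 E0 E6; field; rewrite p0 q0 n3 n4.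
Qed.

Lemma rank2_core31 p q w0 w1 w2 w3 w4 w5 w6 w7 w8 : p != 0 -> q != 0 ->
  w2 != 0 -> w3 != 0 -> w4 != 0 -> w5 != 0 -> w6 != 0 ->
  w0 * w2 = (p * q ^+ 2)^-1 + w1 -> w1 * w3 = (p * q ^+ 3)^-1 + w2 ^+ 3 ->
  w2 * w4 = q^-1 + w3 ->
  w3 * w5 = p + w4 ^+ 3 -> w4 * w6 = p * q + w5 ->
  w5 * w7 = p ^+ 2 * q ^+ 3 + w6 ^+ 3 -> w6 * w8 = p * q ^+ 2 + w7 ->
  w8 = w0 * (p * q ^+ 2).
Proof.
move=> p0 q0 n2 n3 n4 n5 n6 e0 e1 e2 e3 e4 e5 e6.
have E5 : w5 = (p + w4 ^+ 3) / w3 by apply: (mulfI n3); rewrite e3; field.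
have E6 : w6 = (p * q * w3 + p + w4 ^+ 3) / (w3 * w4).
  by apply: (mulfI n4); rewrite e4 E5; field; rewrite n3 n4.
have E7 : w7 = (p ^+ 2 * q ^+ 3 * w3 ^+ 3 + 3%:R * (p * q * w3) ^+ 2 +
    3%:R * (p * q * w3) * (p + w4 ^+ 3) + (p + w4 ^+ 3) ^+ 2) / (w3 ^+ 2 * w4 ^+ 3).
  by apply: (mulfI n5); rewrite e5 E6 E5; field; rewrite n3 n4.
have E2 : w2 = (1 + q * w3) / (q * w4).
  by apply: (mulIf n4); rewrite e2; field; rewrite q0 n4.
have E1 : w1 = (w4 ^+ 3 + p * (1 + q * w3) ^+ 3) / (p * q ^+ 3 * w3 * w4 ^+ 3).
  by apply: (mulIf n3); rewrite e1 E2; field; rewrite p0 q0 n3 n4.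
have E0 : w0 = (w4 ^+ 3 + p * (1 + q * w3) ^+ 2) / (p * q ^+ 2 * w3 * w4 ^+ 2).
  by apply: (mulIf n2); rewrite e0 E1 E2; field; rewrite p0 q0 n3 n4.
by apply: (mulfI n6); rewrite e6 E7 E0 E6; field; rewrite p0 q0 n3 n4.
Qed.

End RankTwoFieldIdentities.

Section RankTwoSequence.
Variables (K : fieldType) (P : finType) (Q : pred P) (z : P -> K).
Hypothesis z_neq0 : forall p, Q p -> z p != 0.

Definition zmon (f : P -> int) : K := \prod_(p | Q p) z p ^ f p.

Lemma zmon_neq0 f : zmon f != 0.
Proof. by apply/prodf_neq0 => p Qp; rewrite expfz_neq0 // z_neq0. Qed.

Lemma zmonD f g h : (forall p, h p = f p + g p) -> zmon h = zmon f * zmon g.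
Proof.
by move=> hE; rewrite -big_split; apply: eq_bigr => p Qp; rewrite hE expfzDr // z_neq0.
Qed.

Lemma zmonM (n : int) f g : (forall p, g p = n * f p) -> zmon g = zmon f ^ n.
Proof.
move=> gE; rewrite /zmon.
rewrite (big_morph (fun x : K => x ^ n) (fun x y => expfzMl x y n) (exp1rz K n)).
by apply: eq_bigr => p _; rewrite gE mulrC exprz_exp.
Qed.

Lemma zmon2 (i j : int) f g h : (forall p, h p = i * f p + j * g p) ->
  zmon h = zmon f ^ i * zmon g ^ j.
Proof.
move=> hE; rewrite (zmonD (f := fun p => i * f p) (g := fun p => j * g p)) //.
by congr (_ * _); apply: zmonM.
Qed.

Definition alternating (a c n : nat) : nat := if odd n then c else a.

(** Step n exchanges [w n] for [w n.+2] while [w n.+1] stays; [s n] holds the exponents of all other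
    variables in that exchange. *)
Definition rank2_recurrence (a c : nat) (s : nat -> P -> int) (w : nat -> K) :=
  [/\ forall n, w n != 0,
    forall n p, s n.+2 p = - s n p +
      (alternating a c n.+1)%:Z * pos_part (s n.+1 p) &
    forall n, w n * w n.+2 = zmon (fun p => pos_part (s n p)) +
      zmon (fun p => pos_part (- s n p)) * w n.+1 ^+ alternating a c n.+1].

Lemma rank2_recurrence_shift a c s w : rank2_recurrence a c s w ->
  rank2_recurrence c a (fun n => s n.+1) (fun n => w n.+1).
Proof.
have altS n : alternating c a n = alternating a c n.+1.
  by rewrite /alternating /=; case: odd.
by case=> h1 h2 h3; split=> *; rewrite ?altS.
Qed.

Section Rescaling.
Variables (a c : nat) (s : nat -> P -> int) (w : nat -> K).
Hypothesis rec : rank2_recurrence a c s w.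
Local Notation e := (alternating a c).

Let w_neq0 n : w n != 0. Proof. by case: rec. Qed.
Let wE n : w n * w n.+2 = zmon (fun p => pos_part (s n p)) +
  zmon (fun p => pos_part (- s n p)) * w n.+1 ^+ e n.+1.
Proof. by case: rec. Qed.

(* Rescaling by monomials makes the coefficients linear in the exchange data. *)
Lemma rescaled_exchange n (f f1 f2 h : P -> int) :
  (forall p, f2 p = - f p + pos_part (- s n p) + (e n.+1)%:Z * f1 p) ->
  (forall p, h p = s n p - (e n.+1)%:Z * f1 p) ->
  (w n / zmon f) * (w n.+2 / zmon f2) = zmon h + (w n.+1 / zmon f1) ^+ e n.+1.
Proof.
move=> f2E hE; set N := fun p => pos_part (- s n p).
have nz := zmon_neq0; pose M := zmon f1 ^+ e n.+1.
have M0 : M != 0 by rewrite expf_neq0.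
have ff2 : zmon f * zmon f2 = zmon N * M.
  rewrite -(zmonD (h := fun p => N p + (e n.+1)%:Z * f1 p)).
    rewrite (zmonD (f := N) (g := fun p => (e n.+1)%:Z * f1 p)) //.
    by congr (_ * _); rewrite /M exprnP; apply: zmonM.
  by move=> p; rewrite f2E /N; ring.
have PE : zmon (fun p => pos_part (s n p)) = zmon h * (zmon N * M).
  rewrite -ff2; apply: esym; rewrite -[LHS]mul1r.
  rewrite -(zmonD (h := fun p => f p + f2 p)) //.
  rewrite -(zmonD (h := fun p => h p + (f p + f2 p))) // mul1r.
  apply: eq_bigr => p _; congr (_ ^ _); rewrite hE f2E.
  by have := pos_part_sub (s n p); lra.
rewrite mulrACA -invfM ff2 wE PE expr_div_n -/M -/N.
by field; rewrite nz M0.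
Qed.

Lemma zmon_ratio n m (f g h : P -> int) : w n / zmon f = w m / zmon g * zmon h ->
  (forall p, g p = f p + h p) -> w n = w m.
Proof.
move=> wE' gE; have nz := zmon_neq0.
apply: (mulIf (invr_neq0 (nz f))); rewrite wE' (zmonD gE).
by field; rewrite !nz.
Qed.

(** The form used below: after rescaling, the coefficient is a monomial with exponents i, j in the
    two coefficients attached to the middle cluster [w m.+1], [w m.+2]. *)
Lemma rescaled_step m n (f : nat -> P -> int) (i j : int) (k : K) :
  (forall p, f n.+2 p = - f n p + pos_part (- s n p) + (e n.+1)%:Z * f n.+1 p) ->
  (forall p, s n p - (e n.+1)%:Z * f n.+1 p = i * s m.+1 p + j * - s m p) ->
  zmon (s m.+1) ^ i * zmon (fun p => - s m p) ^ j = k ->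
  (w n / zmon (f n)) * (w n.+2 / zmon (f n.+2)) =
    k + (w n.+1 / zmon (f n.+1)) ^+ e n.+1.
Proof.
move=> fE hE <-; rewrite (rescaled_exchange (h := fun p => i * s m.+1 p + j * - s m p)
  fE) //; congr (_ + _); exact: zmon2.
Qed.

End Rescaling.

(** The rank-two finite types A1 x A1, A2, B2 and G2, the last two in both orientations; N is the
    Coxeter number plus 2. *)
Definition finite_rank2 (a c N : nat) := (a, c, N) \in
  [:: (0, 0, 4); (1, 1, 5); (1, 2, 6); (2, 1, 6); (1, 3, 8); (3, 1, 8)]%N.

(** The recurrence expresses s 2 up to s 6 piecewise linearly in s 0 and s 1, so these identities
    are settled by [lia]. *)
Ltac piecewise_linear f nu sE s :=
  let p := fresh "p" in move=> p;
  move: (sE 0%N p) (sE 1%N p) (sE 2%N p) (sE 3%N p) (sE 4%N p);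
  rewrite /f /nu /alternating /pos_part /=; lia.

Lemma rank2_period00 s w : rank2_recurrence 0 0 s w -> w 4%N = w 0%N.
Proof.
move=> [w0 sE wE]; apply: (mulfI (w0 2%N)); rewrite wE [RHS]mulrC wE !mulr1 addrC.
by congr (_ + _); apply: eq_bigr => p _; rewrite sE mul0r addr0 ?opprK.
Qed.

Lemma rank2_period11 s w : rank2_recurrence 1 1 s w -> w 5%N = w 0%N.
Proof.
move=> rec; have [w0 sE _] := rec; have nz := zmon_neq0.
pose nu n p := pos_part (- s n p).
(* The exponents vanish on the middle cluster, here at 1 and 2, and are propagated in both
   directions by the recurrence required in [rescaled_step]. The longer periods use the same
   construction with the middle at 2 and 3, or at 3 and 4. *)
pose f n : P -> int := match n with
  | 0 => nu 0%N
  | 3 => nu 1%N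
  | 4 => fun p => nu 2%N p + nu 1%N p
  | 5 => fun p => nu 3%N p + nu 2%N p
  | _ => fun=> 0 end.
pose W n := w n / zmon (f n).
have W0 n : W n != 0 by rewrite mulf_neq0 ?invr_neq0.
pose Y1 := zmon (s 1%N); pose Y2 := zmon (fun p => - s 0%N p).
have S0 : W 0%N * W 2%N = Y2^-1 + W 1%N.
  apply: (@rescaled_step _ _ _ _ rec 0 0 f (0) (-1));
    [piecewise_linear f nu sE s|piecewise_linear f nu sE s|].
  by rewrite ?expr0z ?mul1r ?mulr1.
have S1 : W 1%N * W 3%N = Y1 + W 2%N.
  apply: (@rescaled_step _ _ _ _ rec 0 1 f (1) (0));
    [piecewise_linear f nu sE s|piecewise_linear f nu sE s|].
  by rewrite ?expr0z ?mul1r ?mulr1.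
have S2 : W 2%N * W 4%N = Y1 * Y2 + W 3%N.
  apply: (@rescaled_step _ _ _ _ rec 0 2 f (1) (1));
    [piecewise_linear f nu sE s|piecewise_linear f nu sE s|].
  by rewrite ?expr0z ?mul1r ?mulr1.
have S3 : W 3%N * W 5%N = Y2 + W 4%N.
  apply: (@rescaled_step _ _ _ _ rec 0 3 f (0) (1));
    [piecewise_linear f nu sE s|piecewise_linear f nu sE s|].
  by rewrite ?expr0z ?mul1r ?mulr1.
(* The rescaled variables are periodic only up to a monomial, which the exponent identity between
   [f 0] and [f 5] absorbs. *)
apply: (zmon_ratio (f := f 5%N) (g := f 0%N)
  (h := fun p => 0 * s 1%N p + 1 * - s 0%N p)).
  rewrite [X in _ = _ * X](zmon2 (i := 0) (j := 1) (f := s 1%N) (g := fun p => - s 0%N p)) //.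
  have -> : zmon (s 1%N) ^ 0 * zmon (fun p => - s 0%N p) ^ 1 = Y2.
    by rewrite ?expr0z ?mul1r.
  exact: (rank2_core11 (nz _) (W0 1%N) (W0 2%N) (W0 3%N) S0 S1 S2 S3).
piecewise_linear f nu sE s.
Qed.

Lemma rank2_period12 s w : rank2_recurrence 1 2 s w -> w 6%N = w 0%N.
Proof.
move=> rec; have [w0 sE _] := rec; have nz := zmon_neq0.
pose nu n p := pos_part (- s n p).
pose f n : P -> int := match n with
  | 0 => fun p => nu 0%N p + 2 * nu 1%N p
  | 1 => fun p => nu 1%N p
  | 4 => fun p => nu 2%N p
  | 5 => fun p => nu 2%N p + nu 3%N p
  | 6 => fun p => nu 2%N p + 2 * nu 3%N p + nu 4%N p
  | _ => fun=> 0 end.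
pose W n := w n / zmon (f n).
have W0 n : W n != 0 by rewrite mulf_neq0 ?invr_neq0.
pose Y1 := zmon (s 2%N); pose Y2 := zmon (fun p => - s 1%N p).
have S0 : W 0%N * W 2%N = (Y1 * Y2 ^+ 2)^-1 + W 1%N ^+ 2.
  apply: (@rescaled_step _ _ _ _ rec 1 0 f (-1) (-2));
    [piecewise_linear f nu sE s|piecewise_linear f nu sE s|].
  exact: esym (invfM _ _).
have S1 : W 1%N * W 3%N = Y2^-1 + W 2%N.
  apply: (@rescaled_step _ _ _ _ rec 1 1 f (0) (-1));
    [piecewise_linear f nu sE s|piecewise_linear f nu sE s|].
  by rewrite ?expr0z ?mul1r ?mulr1.
have S2 : W 2%N * W 4%N = Y1 + W 3%N ^+ 2.
  apply: (@rescaled_step _ _ _ _ rec 1 2 f (1) (0));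
    [piecewise_linear f nu sE s|piecewise_linear f nu sE s|].
  by rewrite ?expr0z ?mul1r ?mulr1.
have S3 : W 3%N * W 5%N = Y1 * Y2 + W 4%N.
  apply: (@rescaled_step _ _ _ _ rec 1 3 f (1) (1));
    [piecewise_linear f nu sE s|piecewise_linear f nu sE s|].
  by rewrite ?expr0z ?mul1r ?mulr1.
have S4 : W 4%N * W 6%N = Y1 * Y2 ^+ 2 + W 5%N ^+ 2.
  apply: (@rescaled_step _ _ _ _ rec 1 4 f (1) (2));
    [piecewise_linear f nu sE s|piecewise_linear f nu sE s|].
  by rewrite ?expr0z ?mul1r ?mulr1.
apply: (zmon_ratio (f := f 6%N) (g := f 0%N)
  (h := fun p => 1 * s 2%N p + 2 * - s 1%N p)).
  rewrite [X in _ = _ * X](zmon2 (i := 1) (j := 2) (f := s 2%N) (g := fun p => - s 1%N p)) //.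
  have -> : zmon (s 2%N) ^ 1 * zmon (fun p => - s 1%N p) ^ 2 = Y1 * Y2 ^+ 2.
    by rewrite ?expr0z ?mul1r.
  exact: (rank2_core12 (nz _) (nz _) (W0 2%N) (W0 3%N) (W0 4%N) S0 S1 S2 S3 S4).
piecewise_linear f nu sE s.
Qed.

Lemma rank2_period21 s w : rank2_recurrence 2 1 s w -> w 6%N = w 0%N.
Proof.
move=> rec; have [w0 sE _] := rec; have nz := zmon_neq0.
pose nu n p := pos_part (- s n p).
pose f n : P -> int := match n with
  | 0 => fun p => nu 0%N p + nu 1%N p
  | 1 => fun p => nu 1%N p
  | 4 => fun p => nu 2%N p
  | 5 => fun p => 2 * nu 2%N p + nu 3%N p
  | 6 => fun p => nu 2%N p + nu 3%N p + nu 4%N p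
  | _ => fun=> 0 end.
pose W n := w n / zmon (f n).
have W0 n : W n != 0 by rewrite mulf_neq0 ?invr_neq0.
pose Y1 := zmon (s 2%N); pose Y2 := zmon (fun p => - s 1%N p).
have S0 : W 0%N * W 2%N = (Y1 * Y2)^-1 + W 1%N.
  apply: (@rescaled_step _ _ _ _ rec 1 0 f (-1) (-1));
    [piecewise_linear f nu sE s|piecewise_linear f nu sE s|].
  exact: esym (invfM _ _).
have S1 : W 1%N * W 3%N = Y2^-1 + W 2%N ^+ 2.
  apply: (@rescaled_step _ _ _ _ rec 1 1 f (0) (-1));
    [piecewise_linear f nu sE s|piecewise_linear f nu sE s|].
  by rewrite ?expr0z ?mul1r ?mulr1.
have S2 : W 2%N * W 4%N = Y1 + W 3%N.
  apply: (@rescaled_step _ _ _ _ rec 1 2 f (1) (0));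
    [piecewise_linear f nu sE s|piecewise_linear f nu sE s|].
  by rewrite ?expr0z ?mul1r ?mulr1.
have S3 : W 3%N * W 5%N = Y1 ^+ 2 * Y2 + W 4%N ^+ 2.
  apply: (@rescaled_step _ _ _ _ rec 1 3 f (2) (1));
    [piecewise_linear f nu sE s|piecewise_linear f nu sE s|].
  by rewrite ?expr0z ?mul1r ?mulr1.
have S4 : W 4%N * W 6%N = Y1 * Y2 + W 5%N.
  apply: (@rescaled_step _ _ _ _ rec 1 4 f (1) (1));
    [piecewise_linear f nu sE s|piecewise_linear f nu sE s|].
  by rewrite ?expr0z ?mul1r ?mulr1.
apply: (zmon_ratio (f := f 6%N) (g := f 0%N)
  (h := fun p => 1 * s 2%N p + 1 * - s 1%N p)).
  rewrite [X in _ = _ * X](zmon2 (i := 1) (j := 1) (f := s 2%N) (g := fun p => - s 1%N p)) //.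
  have -> : zmon (s 2%N) ^ 1 * zmon (fun p => - s 1%N p) ^ 1 = Y1 * Y2.
    by rewrite ?expr0z ?mul1r.
  exact: (rank2_core21 (nz _) (nz _) (W0 2%N) (W0 3%N) (W0 4%N) S0 S1 S2 S3 S4).
piecewise_linear f nu sE s.
Qed.

Lemma rank2_period13 s w : rank2_recurrence 1 3 s w -> w 8%N = w 0%N.
Proof.
move=> rec; have [w0 sE _] := rec; have nz := zmon_neq0.
pose nu n p := pos_part (- s n p).
pose f n : P -> int := match n with
  | 0 => fun p => nu 0%N p + 3 * nu 1%N p + 2 * nu 2%N p
  | 1 => fun p => nu 1%N p + nu 2%N p
  | 2 => fun p => nu 2%N p
  | 5 => fun p => nu 3%N p
  | 6 => fun p => 3 * nu 3%N p + nu 4%N p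
  | 7 => fun p => 2 * nu 3%N p + nu 4%N p + nu 5%N p
  | 8 => fun p => 3 * nu 3%N p + 2 * nu 4%N p + 3 * nu 5%N p + nu 6%N p
  | _ => fun=> 0 end.
pose W n := w n / zmon (f n).
have W0 n : W n != 0 by rewrite mulf_neq0 ?invr_neq0.
pose Y1 := zmon (s 3%N); pose Y2 := zmon (fun p => - s 2%N p).
have S0 : W 0%N * W 2%N = (Y1 ^+ 3 * Y2 ^+ 2)^-1 + W 1%N ^+ 3.
  apply: (@rescaled_step _ _ _ _ rec 2 0 f (-3) (-2));
    [piecewise_linear f nu sE s|piecewise_linear f nu sE s|].
  exact: esym (invfM _ _).
have S1 : W 1%N * W 3%N = (Y1 * Y2)^-1 + W 2%N.
  apply: (@rescaled_step _ _ _ _ rec 2 1 f (-1) (-1));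
    [piecewise_linear f nu sE s|piecewise_linear f nu sE s|].
  exact: esym (invfM _ _).
have S2 : W 2%N * W 4%N = Y2^-1 + W 3%N ^+ 3.
  apply: (@rescaled_step _ _ _ _ rec 2 2 f (0) (-1));
    [piecewise_linear f nu sE s|piecewise_linear f nu sE s|].
  by rewrite ?expr0z ?mul1r ?mulr1.
have S3 : W 3%N * W 5%N = Y1 + W 4%N.
  apply: (@rescaled_step _ _ _ _ rec 2 3 f (1) (0));
    [piecewise_linear f nu sE s|piecewise_linear f nu sE s|].
  by rewrite ?expr0z ?mul1r ?mulr1.
have S4 : W 4%N * W 6%N = Y1 ^+ 3 * Y2 + W 5%N ^+ 3.
  apply: (@rescaled_step _ _ _ _ rec 2 4 f (3) (1));
    [piecewise_linear f nu sE s|piecewise_linear f nu sE s|].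
  by rewrite ?expr0z ?mul1r ?mulr1.
have S5 : W 5%N * W 7%N = Y1 ^+ 2 * Y2 + W 6%N.
  apply: (@rescaled_step _ _ _ _ rec 2 5 f (2) (1));
    [piecewise_linear f nu sE s|piecewise_linear f nu sE s|].
  by rewrite ?expr0z ?mul1r ?mulr1.
have S6 : W 6%N * W 8%N = Y1 ^+ 3 * Y2 ^+ 2 + W 7%N ^+ 3.
  apply: (@rescaled_step _ _ _ _ rec 2 6 f (3) (2));
    [piecewise_linear f nu sE s|piecewise_linear f nu sE s|].
  by rewrite ?expr0z ?mul1r ?mulr1.
apply: (zmon_ratio (f := f 8%N) (g := f 0%N)
  (h := fun p => 3 * s 3%N p + 2 * - s 2%N p)).
  rewrite [X in _ = _ * X](zmon2 (i := 3) (j := 2) (f := s 3%N) (g := fun p => - s 2%N p)) //.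
  have -> : zmon (s 3%N) ^ 3 * zmon (fun p => - s 2%N p) ^ 2 = Y1 ^+ 3 * Y2 ^+ 2.
    by rewrite ?expr0z ?mul1r.
  exact: (rank2_core13 (nz _) (nz _) (W0 2%N) (W0 3%N) (W0 4%N) (W0 5%N) (W0 6%N) S0 S1 S2 S3 S4 S5 S6).
piecewise_linear f nu sE s.
Qed.

Lemma rank2_period31 s w : rank2_recurrence 3 1 s w -> w 8%N = w 0%N.
Proof.
move=> rec; have [w0 sE _] := rec; have nz := zmon_neq0.
pose nu n p := pos_part (- s n p).
pose f n : P -> int := match n with
  | 0 => fun p => nu 0%N p + nu 1%N p + 2 * nu 2%N p
  | 1 => fun p => nu 1%N p + 3 * nu 2%N p
  | 2 => fun p => nu 2%N p
  | 5 => fun p => nu 3%N p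
  | 6 => fun p => nu 3%N p + nu 4%N p
  | 7 => fun p => 2 * nu 3%N p + 3 * nu 4%N p + nu 5%N p
  | 8 => fun p => nu 3%N p + 2 * nu 4%N p + nu 5%N p + nu 6%N p
  | _ => fun=> 0 end.
pose W n := w n / zmon (f n).
have W0 n : W n != 0 by rewrite mulf_neq0 ?invr_neq0.
pose Y1 := zmon (s 3%N); pose Y2 := zmon (fun p => - s 2%N p).
have S0 : W 0%N * W 2%N = (Y1 * Y2 ^+ 2)^-1 + W 1%N.
  apply: (@rescaled_step _ _ _ _ rec 2 0 f (-1) (-2));
    [piecewise_linear f nu sE s|piecewise_linear f nu sE s|].
  exact: esym (invfM _ _).
have S1 : W 1%N * W 3%N = (Y1 * Y2 ^+ 3)^-1 + W 2%N ^+ 3.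
  apply: (@rescaled_step _ _ _ _ rec 2 1 f (-1) (-3));
    [piecewise_linear f nu sE s|piecewise_linear f nu sE s|].
  exact: esym (invfM _ _).
have S2 : W 2%N * W 4%N = Y2^-1 + W 3%N.
  apply: (@rescaled_step _ _ _ _ rec 2 2 f (0) (-1));
    [piecewise_linear f nu sE s|piecewise_linear f nu sE s|].
  by rewrite ?expr0z ?mul1r ?mulr1.
have S3 : W 3%N * W 5%N = Y1 + W 4%N ^+ 3.
  apply: (@rescaled_step _ _ _ _ rec 2 3 f (1) (0));
    [piecewise_linear f nu sE s|piecewise_linear f nu sE s|].
  by rewrite ?expr0z ?mul1r ?mulr1.
have S4 : W 4%N * W 6%N = Y1 * Y2 + W 5%N.
  apply: (@rescaled_step _ _ _ _ rec 2 4 f (1) (1));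
    [piecewise_linear f nu sE s|piecewise_linear f nu sE s|].
  by rewrite ?expr0z ?mul1r ?mulr1.
have S5 : W 5%N * W 7%N = Y1 ^+ 2 * Y2 ^+ 3 + W 6%N ^+ 3.
  apply: (@rescaled_step _ _ _ _ rec 2 5 f (2) (3));
    [piecewise_linear f nu sE s|piecewise_linear f nu sE s|].
  by rewrite ?expr0z ?mul1r ?mulr1.
have S6 : W 6%N * W 8%N = Y1 * Y2 ^+ 2 + W 7%N.
  apply: (@rescaled_step _ _ _ _ rec 2 6 f (1) (2));
    [piecewise_linear f nu sE s|piecewise_linear f nu sE s|].
  by rewrite ?expr0z ?mul1r ?mulr1.
apply: (zmon_ratio (f := f 8%N) (g := f 0%N)
  (h := fun p => 1 * s 3%N p + 2 * - s 2%N p)).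
  rewrite [X in _ = _ * X](zmon2 (i := 1) (j := 2) (f := s 3%N) (g := fun p => - s 2%N p)) //.
  have -> : zmon (s 3%N) ^ 1 * zmon (fun p => - s 2%N p) ^ 2 = Y1 * Y2 ^+ 2.
    by rewrite ?expr0z ?mul1r.
  exact: (rank2_core31 (nz _) (nz _) (W0 2%N) (W0 3%N) (W0 4%N) (W0 5%N) (W0 6%N) S0 S1 S2 S3 S4 S5 S6).
piecewise_linear f nu sE s.
Qed.

Lemma rank2_period a c N s w : finite_rank2 a c N ->
  rank2_recurrence a c s w -> w N = w 0%N /\ w N.+1 = w 1%N.
Proof.
have per a' c' N' s' w' : finite_rank2 a' c' N' -> rank2_recurrence a' c' s' w' ->
    w' N' = w' 0%N.
  rewrite /finite_rank2 !inE => /or4P[|||/orP[|/orP[]]] /eqP[-> -> ->];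
  [exact: rank2_period00|exact: rank2_period11|exact: rank2_period12|
   exact: rank2_period21|exact: rank2_period13|exact: rank2_period31].
move=> fin rec; split; first exact: per rec.
(* Shifting by one step swaps a and c, and the list of finite types is symmetric. *)
have fin' : finite_rank2 c a N.
  by move: fin; rewrite /finite_rank2 !inE => /or4P[|||/orP[|/orP[]]] /eqP[-> -> ->].
exact: per fin' (rank2_recurrence_shift rec).
Qed.

End RankTwoSequence.

(** * Seeds *)

Section PositiveElements.
Variable I : finType.
Local Notation K := (ambient_field I).

(* Subtraction-free expressions are of this form, and such elements do not vanish. *)
Definition positive_element (x : K) := exists f g : {mpoly rat[#|{: I + I}|]},
  [/\ 0 < f.@[fun=> 1], 0 < g.@[fun=> 1] & x = FracField.tofrac f / FracField.tofrac g].

Lemma tofrac_positive_neq0 (f : {mpoly rat[#|{: I + I}|]}) :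
  0 < f.@[fun=> 1] -> FracField.tofrac f != 0 :> K.
Proof. by rewrite tofrac_eq0; apply: contraTneq => ->; rewrite meval0 ltxx. Qed.

Lemma positive_neq0 x : positive_element x -> x != 0.
Proof.
by case=> f [g [f0 g0 ->]]; rewrite mulf_neq0 ?invr_eq0 ?tofrac_positive_neq0.
Qed.

Lemma positiveD x y : positive_element x -> positive_element y -> positive_element (x + y).
Proof.
case=> f [g [f0 g0 ->]] [f' [g' [f0' g0' ->]]]; exists (f * g' + f' * g), (g * g').
rewrite mevalD !mevalM; split; [by rewrite addr_gt0 ?mulr_gt0|exact: mulr_gt0|].
by rewrite tofracD !tofracM addf_div ?tofrac_positive_neq0.
Qed.

Lemma positiveM x y : positive_element x -> positive_element y -> positive_element (x * y).
Proof.
case=> f [g [f0 g0 ->]] [f' [g' [f0' g0' ->]]]; exists (f * f'), (g * g').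
by rewrite !mevalM !tofracM invfM mulrACA; split=> //; exact: mulr_gt0.
Qed.

Lemma positiveV x : positive_element x -> positive_element x^-1.
Proof. by case=> f [g [f0 g0 ->]]; exists g, f; rewrite invfM invrK mulrC. Qed.

Lemma positive1 : positive_element 1.
Proof. by exists 1, 1; rewrite meval1 tofrac1 divr1; split. Qed.

Lemma positiveX x n : positive_element x -> positive_element (x ^+ n).
Proof.
by move=> px; elim: n => [|n IH]; rewrite ?expr0 ?exprS; [exact: positive1|exact: positiveM].
Qed.

Lemma positive_var p : positive_element (ambient_var p).
Proof.
exists 'X_(enum_rank p), 1; rewrite meval1 mevalXU tofrac1 divr1.
by split.
Qed.

End PositiveElements.

Section SeedMutation.
Variable I : finType.
Implicit Types (S T : seed I) (k l q : I) (p : I + I).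

Definition positive_seed S := forall i, positive_element (cluster_var S i).

Lemma positive_seed_var S p : positive_seed S -> positive_element (seed_var S p).
Proof. by move=> pS; case: p => i //=; exact: positive_var. Qed.

Lemma positive_initial (B : I -> I -> int) : positive_seed (initial_seed B).
Proof. by move=> i; exact: positive_var. Qed.

Lemma positive_monomial S m : positive_seed S -> positive_element (exchange_monomial S m).
Proof.
move=> pS; apply: (big_ind (@positive_element I)) => [|x y|p _].
- exact: positive1.
- exact: positiveM.
- by apply: positiveX; exact: positive_seed_var.
Qed.

Lemma positive_mutate S k : positive_seed S -> positive_seed (mutate k S).
Proof.
move=> pS i /=; case: ifP => // _; apply: positiveM; first exact: positiveV.
by apply: positiveD; exact: positive_monomial.
Qed.

Lemma exchange_monomial_eq S T m m' : m =1 m' ->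
  (forall p, m p != 0 -> seed_var S p = seed_var T p) ->
  exchange_monomial S m = exchange_monomial T m'.
Proof.
move=> mm' ST; apply: eq_bigr => p _; rewrite -mm'.
have [->|/ST->//] := eqVneq (m p) 0.
by rewrite pos_partE lexx !expr0.
Qed.

Lemma mutate_cluster S k q : cluster_var (mutate k S) q =
  if q == k then (cluster_var S k)^-1 *
    (exchange_monomial S (fun p => ext_matrix S p k) +
     exchange_monomial S (fun p => - ext_matrix S p k))
  else cluster_var S q.
Proof. by []. Qed.

Lemma mutate_matrix S k p q : ext_matrix (mutate k S) p q =
  if (p == inl k) || (q == k) then - ext_matrix S p q
  else ext_matrix S p q + Num.sg (ext_matrix S p k) *
    pos_part (ext_matrix S p k * ext_matrix S (inl k) q).
Proof. by []. Qed.

Lemma mutateK S k : positive_seed S -> ext_matrix S (inl k) k = 0 ->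
  mutate k (mutate k S) = S.
Proof.
move=> pS bk; have var_eq p : p != inl k -> seed_var (mutate k S) p = seed_var S p.
  by case: p => [i|i] //=; rewrite (inj_eq inl_inj) => /negPf->.
have M1 : exchange_monomial (mutate k S) (fun p => ext_matrix (mutate k S) p k) =
    exchange_monomial S (fun p => - ext_matrix S p k).
  apply: exchange_monomial_eq => p; first by rewrite /= eqxx orbT.
  by move=> mp; apply: var_eq; apply: contraNneq mp => ->; rewrite /= !eqxx bk oppr0.
have M2 : exchange_monomial (mutate k S) (fun p => - ext_matrix (mutate k S) p k) =
    exchange_monomial S (fun p => ext_matrix S p k).
  apply: exchange_monomial_eq => p; first by rewrite /= eqxx orbT opprK.
  by move=> mp; apply: var_eq; apply: contraNneq mp => ->; rewrite /= !eqxx bk !oppr0.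
have x0 : cluster_var (mutate k (mutate k S)) =1 cluster_var S.
  move=> q; rewrite mutate_cluster; case: (eqVneq q k) => [->|qk]; last first.
    by rewrite mutate_cluster (negPf qk).
  rewrite M1 M2 mutate_cluster eqxx.
  set M := exchange_monomial _ _; set N := exchange_monomial _ _.
  (* Positivity keeps the exchange binomial nonzero, so it cancels. *)
  have n0 : M + N != 0.
    by rewrite positive_neq0 //; apply: positiveD; apply: positive_monomial.
  by rewrite [N + M]addrC invfM invrK -mulrA mulVf ?mulr1.
have b0 p q : ext_matrix (mutate k (mutate k S)) p q = ext_matrix S p q.
  case h : ((p == inl k) || (q == k)); first by rewrite !mutate_matrix h opprK.
  rewrite !mutate_matrix h !eqxx orbT orTb sgrN mulrNN mulNr.
  by rewrite -addrA subrr addr0.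
case: S {pS bk var_eq M1 M2} x0 b0 => x b x0 b0; rewrite {1}/mutate; congr Seed.
  exact/funext.
by apply/funext => p; apply/funext => q; exact: b0.
Qed.

(** * Alternating mutations in two directions *)

Section Alternating.
Variables (k k' : I).
Hypothesis kk' : k != k'.

Definition letter n := if odd n then k' else k.

Fixpoint alt_seed S n := if n is m.+1 then mutate (letter m) (alt_seed S m) else S.

Lemma alt_seedS S n : alt_seed S n.+1 = mutate (letter n) (alt_seed S n).
Proof. by []. Qed.

Lemma letterSS n : letter n.+2 = letter n.
Proof. by rewrite /letter /= negbK. Qed.

Lemma letter_neq n : (letter n.+1 == letter n) = false.
Proof. by rewrite /letter /=; case: odd; rewrite /= ?(negPf kk') // eq_sym (negPf kk'). Qed.

Lemma letter_or n l : l != k -> l != k' -> (l == letter n) = false.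
Proof. by rewrite /letter; case: odd => /negPf h /negPf h'. Qed.

Lemma alt_seed_positive S n : positive_seed S -> positive_seed (alt_seed S n).
Proof. by move=> pS; elim: n => // n IH; exact: positive_mutate. Qed.

Lemma alt_seed_other S n l : l != k -> l != k' ->
  cluster_var (alt_seed S n) l = cluster_var S l.
Proof. by move=> lk lk'; elim: n => //= n ->; rewrite letter_or. Qed.

Variables (T : seed I) (a c : nat).
Hypothesis posT : positive_seed T.
Hypothesis bkk : ext_matrix T (inl k) k = 0.
Hypothesis bk'k' : ext_matrix T (inl k') k' = 0.
Hypothesis bkk' : ext_matrix T (inl k) k' = a.
Hypothesis bk'k : ext_matrix T (inl k') k = - c%:Z.
Local Notation Tn := (alt_seed T).
Local Notation e := (alternating a c).

(** Each mutation negates both off-diagonal entries while the two directions swap roles, so the sign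
    pattern relative to the next letter persists. The diagonal stays 0 because opposite entries have
    product at most 0. *)
Lemma alt_matrix n :
  [/\ ext_matrix (Tn n) (inl (letter n)) (letter n) = 0,
      ext_matrix (Tn n) (inl (letter n.+1)) (letter n.+1) = 0,
      ext_matrix (Tn n) (inl (letter n)) (letter n.+1) = e n &
      ext_matrix (Tn n) (inl (letter n.+1)) (letter n) = - (e n.+1)%:Z].
Proof.
have inlE (i j : I) : (inl i == inl j :> I + I) = (i == j) by [].
elim: n => [|n [IH1 IH2 IH3 IH4]]; first by split.
rewrite letterSS; split=> /=.
- rewrite inlE letter_neq /= IH2 IH3 IH4 add0r mulNr.
  by rewrite pos_partE oppr_ge0; case: ifP => [|_]; rewrite ?mulr0 //; 
    case: (e n) (e n.+1) => [|x] [|y] //; rewrite ?mul0r ?mulr0 ?oppr0 ?mulr0.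
- by rewrite inlE eqxx IH1 oppr0.
- by rewrite inlE eqxx orbT IH4 opprK.
- rewrite inlE eqxx IH3; congr (- _%:Z); by rewrite /alternating /= negbK.
Qed.

Local Notation Q := (fun p : I + I => (p != inl k) && (p != inl k')).

Lemma alt_seed_var n p : Q p -> seed_var (Tn n) p = seed_var T p.
Proof.
case: p => //= i; rewrite !(inj_eq inl_inj) => /andP[ik ik'].
exact: alt_seed_other.
Qed.

Lemma letterQ n p : Q p -> (p == inl (letter n)) = false.
Proof. by move=> /andP[/negPf pk /negPf pk']; rewrite /letter; case: odd. Qed.

Lemma alt_cluster n : cluster_var (Tn n) (letter n.+1) = cluster_var (Tn n.+1) (letter n.+1).
Proof. by rewrite /= letter_neq. Qed.

Lemma exchange_monomial_split n (m : I + I -> int) : m (inl (letter n)) = 0 ->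
  exchange_monomial (Tn n) m = zmon Q (seed_var T) (fun p => pos_part (m p)) *
    cluster_var (Tn n.+1) (letter n.+1) ^+ `|pos_part (m (inl (letter n.+1)))|%N.
Proof.
move=> m0; rewrite /exchange_monomial (bigD1 (inl (letter n))) //= m0.
rewrite {1}/pos_part maxxx expr0 mul1r (bigD1 (inl (letter n.+1))) /=; last first.
  by rewrite (inj_eq inl_inj) letter_neq.
rewrite mulrC; congr (_ * _); last by rewrite /= letter_neq.
have QE p : (p != inl (letter n)) && (p != inl (letter n.+1)) = Q p.
  by rewrite /letter /=; case: odd; rewrite // andbC.
apply: eq_big => // p; rewrite QE => Qp; rewrite alt_seed_var //.
by rewrite -[in RHS](gez0_abs (pos_part_ge0 (m p))).
Qed.

(** Setting the exponents to 0 at the two mutated indices keeps their recurrence valid there, and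
    [zmon] runs over Q only. *)
Lemma alt_seed_recurrence : rank2_recurrence Q (seed_var T) a c
  (fun n p => if Q p then ext_matrix (Tn n) p (letter n) else 0)
  (fun n => cluster_var (Tn n) (letter n)).
Proof.
have zmon_eq f g : (forall p, Q p -> f p = g p) ->
    zmon Q (seed_var T) f = zmon Q (seed_var T) g.
  by move=> fg; apply: eq_bigr => p Qp; rewrite fg.
split=> [n|n p|n].
- by apply: positive_neq0; exact: alt_seed_positive.
- case: (boolP (Q p)) => Qp; last by rewrite oppr0 add0r pos_partE lexx mulr0.
  have [_ _ h _] := alt_matrix n.+1; rewrite letterSS in h.
  rewrite letterSS [Tn n.+2]alt_seedS mutate_matrix letterQ // orFb eq_sym letter_neq h.
  rewrite [X in X + _]mutate_matrix letterQ // eqxx orbT; congr (_ + _).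
  set s := ext_matrix _ _ _; rewrite [s * _]mulrC pos_partM // pos_partE.
  case: leP => s0; rewrite ?mulr0 //.
  move: s0; rewrite le_eqVlt => /orP[/eqP<-|s0]; first by rewrite !mulr0.
  by rewrite gtr0_sg // mul1r.
- have [h1 h2 h3 h4] := alt_matrix n.
  have x0 : cluster_var (Tn n) (letter n) != 0.
    by apply: positive_neq0; exact: alt_seed_positive.
  rewrite letterSS [Tn n.+2]alt_seedS mutate_cluster eq_sym letter_neq.
  rewrite [Tn n.+1]alt_seedS mutate_cluster eqxx -alt_seedS mulVKf //.
  rewrite !exchange_monomial_split ?h1 ?oppr0 // h4 opprK.
  rewrite /pos_part [Num.max (- _) _]max_r ?oppr_le0 // max_l // expr0 mulr1 -/(pos_part _).
  congr (_ + _ * _); apply: zmon_eq => p /= ->.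
    by [].
  by [].
Qed.

Lemma alt_seed_period N : finite_rank2 a c N ->
  cluster_var (Tn N) (letter N) = cluster_var T k /\
  cluster_var (Tn N) (letter N.+1) = cluster_var T k'.
Proof.
move=> fin; have nz p : Q p -> seed_var T p != 0.
  by move=> _; apply: positive_neq0; exact: positive_seed_var.
have [h1 h2] := rank2_period nz fin alt_seed_recurrence.
by split; [exact: h1|rewrite alt_cluster h2 -alt_cluster].
Qed.

End Alternating.
End SeedMutation.

Section Relabeling.
Variable I : finType.

Definition relabels (s : {perm I}) (S T : seed I) :=
  [/\ forall i, cluster_var T (s i) = cluster_var S i,
      forall i j, ext_matrix T (inl (s i)) (s j) = ext_matrix S (inl i) j &
      forall i j, ext_matrix T (inr i) (s j) = ext_matrix S (inr i) j].

Lemma relabels_mutate s S T k i : relabels s S T ->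
  cluster_var (mutate (s k) T) (s i) = cluster_var (mutate k S) i.
Proof.
case=> hx hb hc; pose h (p : I + I) := if p is inl i then inl (s i) else p.
pose h' (p : I + I) := if p is inl i then inl ((s^-1)%g i) else p.
have hbij : bijective h.
  by exists h' => -[j|j] //=; rewrite ?permK ?permKV.
have mE (m m' : I + I -> int) : (forall p, m' (h p) = m p) ->
    exchange_monomial T m' = exchange_monomial S m.
  move=> mm; rewrite /exchange_monomial (reindex h) /=; last exact: onW_bij.
  by apply: eq_bigr => p _; rewrite mm; case: p => [j|j] //=; rewrite hx.
rewrite !mutate_cluster (inj_eq perm_inj); case: ifP => // _; rewrite hx.
congr (_ * (_ + _)); apply: mE => -[j|j] /=; by rewrite ?hb ?hc.
Qed.

End Relabeling.

(** If ac >= 4, the inequality 2 t_j <= e_j t_(j+1) propagates and the sequence never becomes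
    negative. The remaining pairs (a, c) are finite in number, and for each the first sign change is
    computed directly; n is then the Coxeter number. *)
Lemma rank2_stop (R : realType) (a c n : nat) (t : nat -> R) :
  (a == 0)%N = (c == 0)%N -> t 0%N < 0 -> 0 < t 1%N ->
  (forall j, t j.+2 = (alternating a c j)%:R * t j.+1 - t j) ->
  (forall j, (0 < j <= n)%N -> 0 < t j) -> t n.+1 < 0 ->
  finite_rank2 a c n.+2.
Proof.
move=> ac t0 t1 tE tpos tn.
have [ac4|ac4] := leqP 4 (a * c).
  suff h j : 0 < t j.+1 /\ 2%:R * t j <= (alternating a c j)%:R * t j.+1.
    by have [] := h n; rewrite ltNge ltW.
  elim: j => [|j [h1 h2]].
    split=> //; apply: (@le_trans _ _ 0); first by rewrite mulr_ge0_le0 // ltW.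
    by rewrite mulr_ge0 ?ler0n // ltW.
  have altS : alternating a c j.+1 = if odd j then a else c.
    by rewrite /alternating /=; case: odd.
  have altE : alternating a c j = if odd j then c else a by [].
  have p0 : (0 < alternating a c j)%N.
    by rewrite altE; clear - ac4; case: odd; nia.
  have p4 : 4%:R <= (alternating a c j)%:R * (alternating a c j.+1)%:R :> R.
    by rewrite altE altS -natrM ler_nat; case: odd; rewrite // mulnC.
  have {}p0 : 0 < (alternating a c j)%:R :> R by rewrite ltr0n.
  have q0 : 0 <= (alternating a c j.+1)%:R :> R by rewrite ler0n.
  rewrite tE; move: h2 p4 p0 q0; set A := (alternating a c j)%:R.
  set C := (alternating a c j.+1)%:R => h2 p4 p0 q0.
  split; first by nra.
  have : C * (2%:R * t j) <= C * (A * t j.+1) by rewrite ler_wpM2l.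
  by nra.
(* Terms up to [t 7] suffice: in the longest case, G2, [t 7 = - t 1] is the first negative one. *)
have t2 := tE 0%N; have t3 := tE 1%N; have t4 := tE 2%N; have t5 := tE 3%N.
have t6 := tE 4%N; have t7 := tE 5%N.
have tp j : (0 < j)%N -> (j <= n)%N -> 0 < t j by move=> j0 jn; apply: tpos; rewrite j0.
have P1 := tp 1%N isT; have P2 := tp 2%N isT; have P3 := tp 3%N isT.
have P4 := tp 4%N isT; have P5 := tp 5%N isT; have P6 := tp 6%N isT.
have P7 := tp 7%N isT.
rewrite /alternating /= in t2 t3 t4 t5 t6 t7.
have [[aE cE]|[[aE cE]|[[aE cE]|[[aE cE]|[[aE cE]|[aE cE]]]]]] :
   (a = 0 /\ c = 0 \/ a = 1 /\ c = 1 \/ a = 1 /\ c = 2 \/ a = 2 /\ c = 1 \/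
    a = 1 /\ c = 3 \/ a = 3 /\ c = 1)%N by nia.
all: subst a c.
all: case: n tn P1 P2 P3 P4 P5 P6 P7 {tpos tp} => [|[|[|[|[|[|[|n]]]]]]] tn P1 P2 P3 P4 P5 P6 P7 //.
all: exfalso; try (have := P2 isT); try (have := P3 isT); try (have := P4 isT);
  try (have := P5 isT); try (have := P6 isT); try (have := P7 isT); clear - t0 t1 t2 t3 t4 t5 t6 t7 tn; lra.
Qed.

(** Half a turn around the rank-two root system takes as many steps as the Coxeter number, n. *)
Lemma rank2_half_period (R : realType) (a c n : nat) (t : nat -> R) :
  (forall j, t j.+2 = (alternating a c j)%:R * t j.+1 - t j) ->
  finite_rank2 a c n.+2 -> t n = - t 0%N /\ t n.+1 = - t 1%N.
Proof.
move=> tE; have t2 := tE 0%N; have t3 := tE 1%N; have t4 := tE 2%N.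
have t5 := tE 3%N; have t6 := tE 4%N; have t7 := tE 5%N.
rewrite /alternating /= in t2 t3 t4 t5 t6 t7.
rewrite /finite_rank2 !inE => /or4P[|||/orP[|/orP[]]] /eqP[aE cE ->]; subst a c;
  clear tE; split; lra.
Qed.

(** * Ampleness *)

Section Ample.
Variables (R : realType) (I : finType) (B : I -> I -> int) (delta : I -> R).
Hypothesis HB : skew_symmetrized_by B delta.
Variable Fr : framework B delta.
Hypothesis desc : descending Fr.
Local Notation G := (graph Fr).
Local Notation rho := (rho R I).
Implicit Types (v w u : vertex G) (e f : edge G) (E : I -> edge G) (S : seed I).
Implicit Types (x : coweightspace R I) (k : I).

(** Matching variables through edges avoids tracking permutations; [marked_relabels] recovers the
    permutation at the end. *)
Definition same_clusters E S E' S' :=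
  forall i j, E i = E' j -> cluster_var S i = cluster_var S' j.

Lemma reach_positive up v E S : reach up v E S -> positive_seed S.
Proof.
elim=> [*|*]; [exact: positive_initial|exact: positive_mutate].
Qed.

Lemma reach_inv up v E S : reach up v E S ->
  [/\ v = base Fr, base_marking E & S = initial_seed B] \/
  exists v1 E1 S1 k, [/\ reach up v1 E1 S1, joins (E1 k) v1 v,
    up -> 0 < pairing rho (lab v1 (E1 k)),
    E = transport v1 v (E1 k) E1 & S = mutate k S1].
Proof.
by case=> [{}E hE|v1 E1 S1 {}v k r j h]; [left|right; exists v1, E1, S1, k].
Qed.

(** Both extended matrices are read off the same labels at v, so agreement of the variables is all
    that has to be assumed. *)
Lemma marked_relabels v E S E' S' : marked v E S -> marked v E' S' ->
  same_clusters E S E' S' ->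
  exists2 s : {perm I}, relabels s S S' & forall i, E' (s i) = E i.
Proof.
move=> mS mS' sim.
have /boolp.choice[f fE] : forall i, exists j, E' j = E i.
  by move=> i; apply: (marked_surj mS'); exact: marked_inc mS i.
have finj : injective f.
  by move=> i j ij; apply: (marked_inj mS); rewrite -!fE ij.
exists (perm finj) => [|i]; last by rewrite permE fE.
split=> [i|i j|p j]; rewrite !permE.
- by apply/esym/sim.
- by apply: (@intr_inj R); rewrite (marked_matrix mS) (marked_matrix mS') !fE.
- by apply: (@intr_inj R); rewrite (marked_coef mS) (marked_coef mS') !fE.
Qed.

Lemma same_clusters_refl v E S : marked v E S -> same_clusters E S E S.
Proof. by move=> mS i j /(marked_inj mS) ->. Qed.

Lemma same_clusters_sym E S E' S' : same_clusters E S E' S' -> same_clusters E' S' E S.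
Proof. by move=> h i j /esym /h. Qed.

Lemma same_clusters_trans v E S E1 S1 E' S' : marked v E S -> marked v E1 S1 ->
  same_clusters E S E1 S1 -> same_clusters E1 S1 E' S' -> same_clusters E S E' S'.
Proof.
move=> mS mS1 h1 h2 i j ij.
have [l lE] := marked_surj mS1 (marked_inc mS i).
by rewrite (h1 i l) // (h2 l j) // lE.
Qed.

Lemma same_clusters_step v w E S E' S' k k' : marked v E S -> marked v E' S' ->
  same_clusters E S E' S' -> E k = E' k' -> joins (E k) v w ->
  same_clusters (transport v w (E k) E) (mutate k S)
    (transport v w (E' k') E') (mutate k' S').
Proof.
move=> mS mS' sim kk jw; have [s rel sE] := marked_relabels mS mS' sim.
have sk : s k = k' by apply: (marked_inj mS'); rewrite sE.
have jw' : joins (E' k') v w by rewrite -kk.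
have [mT' _] := transport_marked HB mS' jw'.
move=> i j ij; have -> : j = s i.
  by apply: (marked_inj mT'); rewrite -ij /transport sE kk.
by rewrite -sk (relabels_mutate _ _ rel).
Qed.

(** On the way back b becomes -b: its sign and [omega] both change, so the same coefficient
    multiplies the opposite root. *)
Lemma transportK v w E S k : marked v E S -> positive_seed S -> joins (E k) v w ->
  let E1 := transport v w (E k) E in
  transport w v (E1 k) E1 =1 E /\ mutate k (mutate k S) = S.
Proof.
move=> mS pS jw E1; have [mS1 lab1] := transport_marked HB mS jw.
have E1k : E1 k = E k by rewrite /E1 /transport /edge_transport asboolT.
have jw' : joins (E1 k) w v by rewrite E1k; exact: joinsC.
have [mS2 lab2] := transport_marked HB mS1 jw'.
have bk : omega B delta (colab v (E k)) (lab v (E k)) = 0.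
  by rewrite (marked_colab mS) omegaZl omega_self ?mulr0.
split; last first.
  apply: mutateK => //; apply: (@intr_inj R).
  by rewrite (marked_matrix mS) bk.
move=> i; have [j jE] := marked_surj mS (marked_inc mS2 i); rewrite -jE.
congr E; apply: (marked_lab_inj mS); rewrite jE lab2 -/E1.
case: eqP => [->|/eqP ik]; first by rewrite E1k (lab_opp jw).1 opprK.
rewrite (lab1 i) (negPf ik) E1k (lab_opp jw).1 (lab_opp jw).2.
rewrite /label_mutation omegaNl omegaDr omegaZr bk mulr0 addr0.
have [s1 s2] := incident_sgn (marked_inc mS k).
have vwE := marked_inc mS1 k; rewrite -/E1 E1k in vwE.
have [s3 s4] := incident_sgn vwE; rewrite (lab_opp jw).1 pairingNr in s3 s4.
have -> : root_sgn (- lab v (E k)) = - root_sgn (lab v (E k)).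
  case: (root_sgn_cases (lab v (E k))) => [h|h]; rewrite h.
    by apply/s4; rewrite oppr_lt0; exact/s1.
  by rewrite opprK; apply/s3; rewrite oppr_gt0; exact/s2.
by rewrite mulrNN scalerN addrK.
Qed.

Lemma marked_diag v E S k : marked v E S -> ext_matrix S (inl k) k = 0.
Proof.
move=> mS; apply: (@intr_inj R); rewrite (marked_matrix mS) (marked_colab mS).
by rewrite omegaZl omega_self ?mulr0.
Qed.

Lemma marked_opposite v E S k k' : marked v E S -> 0 <= ext_matrix S (inl k) k' ->
  ext_matrix S (inl k') k <= 0 /\
  (ext_matrix S (inl k) k' == 0) = (ext_matrix S (inl k') k == 0).
Proof.
move=> mS; have [d0 _] := HB.
rewrite -(ler0z R) -(lerz0 R) -!(intr_eq0 R) !(marked_matrix mS) !(marked_colab mS).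
rewrite !omegaZl (omegaC (lab v (E k')) _ HB) mulrN oppr_le0 oppr_eq0.
have i0 j : 0 < (delta j)^-1 by rewrite invr_gt0.
by rewrite !pmulr_rge0 // !mulf_eq0 !(gt_eqF (i0 _)); split.
Qed.

Lemma marked_sign v E S k k' : marked v E S ->
  0 <= ext_matrix S (inl k) k' \/ 0 <= ext_matrix S (inl k') k.
Proof.
move=> mS; have [d0 _] := HB; have i0 j : 0 < (delta j)^-1 by rewrite invr_gt0.
rewrite -!(ler0z R) !(marked_matrix mS) !(marked_colab mS) !omegaZl !pmulr_rge0 //.
rewrite (omegaC (lab v (E k')) _ HB) oppr_ge0; apply/orP; exact: le_total.
Qed.

Lemma alt_seed_add k k' S n : alt_seed k k' S n.+2 =
  alt_seed k k' (alt_seed k k' S 2) n.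
Proof. by elim: n => // n IH; rewrite alt_seedS IH letterSS. Qed.

(** * Climbing one side of the star of a codimension-two face *)

Section Climb.
Variables (u : vertex G) (E0 : I -> edge G) (S0 : seed I).
Hypothesis reach0 : reach true u E0 S0.

(** One side of the star above u; the order of k and k' selects the side. *)
Fixpoint climb k k' n v E S : Prop := match n with
  | 0 => [/\ v = u, E = E0 & S = S0]
  | m.+1 => exists v1 E1 S1, [/\ climb k k' m v1 E1 S1,
      joins (E1 (letter k k' m)) v1 v,
      0 < pairing rho (lab v1 (E1 (letter k k' m))),
      E = transport v1 v (E1 (letter k k' m)) E1 & S = mutate (letter k k' m) S1]
  end.

Lemma climb_reach k k' n v E S : climb k k' n v E S -> reach true v E S.
Proof.
elim: n v E S => [|n IH] v E S /=; first by case=> -> -> ->.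
by move=> [v1 [E1 [S1 [/IH r j h -> ->]]]]; apply: reach_step.
Qed.

Lemma climb_seed k k' n v E S : climb k k' n v E S -> S = alt_seed k k' S0 n.
Proof.
elim: n v E S => [|n IH] v E S /=; first by case.
by move=> [v1 [E1 [S1 [/IH -> _ _ _ ->]]]].
Qed.

Lemma climb_det k k' n v E S v' E' S' :
  climb k k' n v E S -> climb k k' n v' E' S' -> [/\ v = v', E = E' & S = S'].
Proof.
elim: n v E S v' E' S' => [|n IH] v E S v' E' S' /=.
  by case=> -> -> -> [-> -> ->].
move=> [v1 [E1 [S1 [c1 j1 h1 -> ->]]]] [v2 [E2 [S2 [c2 j2 h2 -> ->]]]].
have [e1 e2 e3] := IH _ _ _ _ _ _ c1 c2; subst v2 E2 S2.
by have e4 := joins_inj j1 j2; subst v'.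
Qed.

(** For x on the codimension-two face, every wall crossed vanishes at x, so mutations do not alter
    values at x. *)
Lemma climb_pairing x k k' n v E S : climb k k' n v E S ->
  pairing x (lab u (E0 k)) = 0 -> pairing x (lab u (E0 k')) = 0 ->
  forall i, pairing x (lab v (E i)) = pairing x (lab u (E0 i)).
Proof.
move=> + xk xk'; elim: n v E S => [|n IH] v E S /=; first by case=> -> ->.
move=> [v1 [E1 [S1 [c1 j1 h1 -> _]]]] i.
have m1 := reach_marked HB (climb_reach c1).
have x0 : pairing x (lab v1 (E1 (letter k k' n))) = 0.
  by rewrite (IH _ _ _ c1) /letter; case: odd.
have [_ ->] := transport_marked HB m1 j1.
case: eqP => [->|_]; last by rewrite pairingDr pairingZr x0 mulr0 addr0 (IH _ _ _ c1).
by rewrite pairingNr x0 oppr0 -(IH _ _ _ c1) x0.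
Qed.

Lemma climb_last k k' n v E S : climb k k' n.+1 v E S ->
  pairing rho (lab v (E (letter k k' n))) < 0.
Proof.
move=> [v1 [E1 [S1 [c1 j1 h1 -> _]]]].
have m1 := reach_marked HB (climb_reach c1).
have [_ ->] := transport_marked HB m1 j1.
by rewrite eqxx pairingNr oppr_lt0.
Qed.

Section Labels.
Variables (k k' : I) (a c : nat).
Hypothesis kk' : k != k'.
Hypothesis qa : pos_part (ext_matrix S0 (inl k) k') = a.
Hypothesis qc : pos_part (- ext_matrix S0 (inl k') k) = c.
Local Notation l := (letter k k').

(** Two consecutive roots met by the climb. The start, minus the label of k', makes the recurrence
    hold from the first step on. *)
Fixpoint root_pair n : rootspace R I * rootspace R I :=
  if n is m.+1 then let: (b, b') := root_pair m in
    (b', (alternating a c m)%:R *: b' - b)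
  else (- lab u (E0 k'), lab u (E0 k)).

Definition root_seq n := (root_pair n).1.

Lemma root_seqE n : root_seq n.+2 =
  (alternating a c n)%:R *: root_seq n.+1 - root_seq n.
Proof. by rewrite /root_seq /=; case: (root_pair n). Qed.

(** Positive parts cover both sides of the star at once: on the side where the entry from the first
    letter to the second is nonpositive, a = c = 0. *)
Lemma alt_offdiag n :
  pos_part (ext_matrix (alt_seed k k' S0 n) (inl (l n)) (l n.+1)) = alternating a c n /\
  pos_part (- ext_matrix (alt_seed k k' S0 n) (inl (l n.+1)) (l n)) = alternating a c n.+1.
Proof.
elim: n => [|n [IH1 IH2]]; first by [].
rewrite letterSS alt_seedS !mutate_matrix !(inj_eq inl_inj) !eqxx orbT opprK /=.
by rewrite IH1 IH2 /alternating /= negbK.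
Qed.

Lemma climb_labels n v E S : climb k k' n v E S ->
  lab v (E (l n)) = root_seq n.+1 /\ lab v (E (l n.+1)) = - root_seq n.
Proof.
elim: n v E S => [|n IH] v E S.
  by case=> -> -> _; rewrite /root_seq /= opprK.
move=> [v1 [E1 [S1 [c1 j1 h1 -> _]]]].
have m1 := reach_marked HB (climb_reach c1); have [IH1 IH2] := IH _ _ _ c1.
have [_ labE] := transport_marked HB m1 j1; rewrite !labE letterSS eqxx letter_neq // IH1.
split=> //; rewrite /label_mutation -IH1.
have -> : root_sgn (lab v1 (E1 (l n))) = 1.
  by apply/(incident_sgn (marked_inc m1 _)).1.
rewrite mul1r -(marked_matrix m1) (climb_seed c1) -pos_part_intr (alt_offdiag n).1.
by rewrite IH1 IH2 root_seqE addrC.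
Qed.

Lemma climb_root_pos n v E S : climb k k' n v E S ->
  forall j, (0 < j <= n)%N -> 0 < pairing rho (root_seq j).
Proof.
elim: n v E S => [|n IH] v E S; first by move=> _ [].
move=> [v1 [E1 [S1 [c1 j1 h1 _ _]]]] j /andP[j0].
rewrite leq_eqVlt => /orP[/eqP->|jn]; last by apply: (IH _ _ _ c1); rewrite j0.
by rewrite -(climb_labels c1).1.
Qed.

End Labels.

(** At the top both labels of the star are negative, so the heights of the roots have just changed
    sign. This identifies the finite type, and the half-period, applied coordinatewise, gives the
    two labels. *)
Lemma climb_stop k k' a c n v E S : k != k' ->
  pos_part (ext_matrix S0 (inl k) k') = a%:Z ->
  pos_part (- ext_matrix S0 (inl k') k) = c%:Z -> (a == 0)%N = (c == 0)%N ->
  0 < pairing rho (lab u (E0 k)) -> 0 < pairing rho (lab u (E0 k')) ->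
  climb k k' n v E S ->
  pairing rho (lab v (E k)) < 0 -> pairing rho (lab v (E k')) < 0 ->
  [/\ finite_rank2 a c n.+2, lab v (E (letter k k' n)) = - lab u (E0 k) &
      lab v (E (letter k k' n.+1)) = - lab u (E0 k')].
Proof.
move=> kk' qa qc ac rk rk' cl nk nk'.
have nl j : pairing rho (lab v (E (letter k k' j))) < 0 by rewrite /letter; case: odd.
have [l1 l2] := climb_labels kk' qa qc cl.
have fin : finite_rank2 a c n.+2.
  apply: (@rank2_stop R a c n (fun j => pairing rho (root_seq k k' a c j))) => //.
  - by rewrite /root_seq /= pairingNr oppr_lt0.
  - by move=> j; rewrite root_seqE pairingDr pairingNr pairingZr.
  - by move=> j hj; have := climb_root_pos kk' qa qc cl hj.
  - by rewrite -l1.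
have per i : root_seq k k' a c n i = - root_seq k k' a c 0%N i /\
    root_seq k k' a c n.+1 i = - root_seq k k' a c 1%N i.
  apply: (@rank2_half_period R a c n (fun j => root_seq k k' a c j i)) => // j.
  by rewrite root_seqE !ffunE.
split=> //; [rewrite l1|rewrite l2]; apply/ffunP => i; rewrite !ffunE.
  by rewrite (per i).2.
by rewrite (per i).1 /root_seq /= !ffunE !opprK.
Qed.

(** Both climbs meet the same roots, and the one of length n ends in front of a negative one, which
    no climb crosses. *)
Lemma climb_length k k' n m v E S v' E' S' : k != k' ->
  climb k k' n v E S -> climb k k' m v' E' S' ->
  pairing rho (lab v (E (letter k k' n))) < 0 -> (m <= n)%N.
Proof.
move=> kk' cl cl' neg; rewrite leqNgt; apply/negP => nm.
have q (z : int) : pos_part z = `|pos_part z|%N by rewrite gez0_abs ?pos_part_ge0.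
have := climb_root_pos kk' (q _) (q _) cl' (j := n.+1) nm.
by rewrite -(climb_labels kk' (q _) (q _) cl).1 => /(lt_trans neg); rewrite ltxx.
Qed.

(** The side starting with k' has a = c = 0, hence length 2. Undoing its two mutations leads from S'
    to S0, and the other side continues with the same alternation; so S is n + 2 alternating
    mutations away from S', which is exactly the period. *)
Lemma polygon k k' n m v E S E' S' : k != k' ->
  0 <= ext_matrix S0 (inl k) k' ->
  0 < pairing rho (lab u (E0 k)) -> 0 < pairing rho (lab u (E0 k')) ->
  climb k k' n v E S -> climb k' k m v E' S' ->
  pairing rho (lab v (E k)) < 0 -> pairing rho (lab v (E k')) < 0 ->
  pairing rho (lab v (E' k)) < 0 -> pairing rho (lab v (E' k')) < 0 ->
  same_clusters E S E' S'.
Proof.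
move=> kk' b0 rk rk' cl cl' nk nk' nk2 nk2'; have k'k : k' != k by rewrite eq_sym.
have m0 := reach_marked HB reach0; have [d0 _] := HB.
have [b'0 bb'] := marked_opposite m0 b0.
set b := ext_matrix S0 (inl k) k' in b0 b'0 bb' *.
set b' := ext_matrix S0 (inl k') k in b'0 bb' *.
have qa : pos_part b = `|b|%N by rewrite pos_partE b0 gez0_abs.
have qc : pos_part (- b') = `|b'|%N by rewrite pos_partE oppr_ge0 b'0 -lez0_abs.
have ac : (`|b| == 0)%N = (`|b'| == 0)%N by rewrite !absz_eq0.
have [fin l1 l2] := climb_stop kk' qa qc ac rk rk' cl nk nk'.
have qa' : pos_part b' = 0%N.
  by rewrite pos_partE; case: ifP => // h; apply: le_anti; rewrite h b'0.
have qc' : pos_part (- b) = 0%N.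
  by rewrite pos_partE oppr_ge0; case: ifP => // h; rewrite (@le_anti _ _ b 0) ?oppr0 // h b0.
have [fin' l1' l2'] := climb_stop k'k qa' qc' erefl rk' rk cl' nk2' nk2.
have m2 : m = 2%N.
  by move: fin'; rewrite /finite_rank2 !inE => /or4P[|||/orP[|/orP[]]] /eqP[].
subst m; rewrite /letter /= in l1' l2'.
have ms := reach_marked HB (climb_reach cl); have ms' := reach_marked HB (climb_reach cl').
have pS' := reach_positive (climb_reach cl').
have S'E : S' = mutate k (mutate k' S0) by rewrite (climb_seed cl').
have SE := climb_seed cl.
have S'2 : alt_seed k k' S' 2 = S0.
  have [v1 [E1 [S1 [c1 _ _ _ _]]]] := cl'.
  have {}c1 : climb k' k 1 v1 E1 S1 := c1.
  have S1E := climb_seed c1; rewrite /= /letter /= in S1E.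
  have r1 := climb_reach c1.
  have d1 : ext_matrix (mutate k' S0) (inl k) k = 0.
    by rewrite -S1E; exact: marked_diag (reach_marked HB r1).
  have p1 : positive_seed (mutate k' S0) by rewrite -S1E; exact: reach_positive r1.
  rewrite /= /letter /= S'E (mutateK p1 d1).
  by rewrite mutateK ?(marked_diag _ m0) //; exact: reach_positive reach0.
have SE' : S = alt_seed k k' S' n.+2.
  by rewrite SE -S'2 -alt_seed_add.
have bT : ext_matrix S' (inl k) k' = `|b|%N.
  by rewrite S'E !mutate_matrix !eqxx ?orbT /= opprK gez0_abs.
have bT' : ext_matrix S' (inl k') k = - `|b'|%N%:Z.
  by rewrite S'E !mutate_matrix !eqxx ?orbT /= opprK lez0_abs ?opprK.
have [p1 p2] := alt_seed_period kk' pS' (marked_diag k ms') (marked_diag k' ms') bT bT' fin.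
rewrite -SE' !letterSS in p1 p2.
have Ek : E (letter k k' n) = E' k.
  have [j jE] := marked_surj ms' (marked_inc ms (letter k k' n)); rewrite -jE.
  by congr E'; apply: (marked_lab_inj ms'); rewrite jE l1 l2'.
have Ek' : E (letter k k' n.+1) = E' k'.
  have [j jE] := marked_surj ms' (marked_inc ms (letter k k' n.+1)); rewrite -jE.
  by congr E'; apply: (marked_lab_inj ms'); rewrite jE l2 l1'.
(* For i other than k and k', the dual vector [g i] vanishes on both walls and follows the i-th
   label unchanged along both sides; equal edges thus have equal indices. *)
have [g [gE _]] := marked_dual m0.
move=> i j ij; have [ik|ik] := eqVneq i (letter k k' n).
  subst i; have -> : j = k by apply: (marked_inj ms'); rewrite -ij.
  by rewrite p1.
have [ik'|ik'] := eqVneq i (letter k k' n.+1).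
  subst i; have -> : j = k' by apply: (marked_inj ms'); rewrite -ij.
  by rewrite p2.
have {ik ik'}[ik ik'] : i != k /\ i != k'.
  by move: ik ik'; rewrite /letter /=; case: odd.
have gk : pairing (g i) (lab u (E0 k)) = 0 by rewrite gE (negPf ik).
have gk' : pairing (g i) (lab u (E0 k')) = 0 by rewrite gE (negPf ik').
have : pairing (g i) (lab v (E i)) = pairing (g i) (lab v (E' j)) by rewrite ij.
rewrite (climb_pairing cl gk gk') (climb_pairing cl' gk' gk) !gE eqxx.
case: eqVneq => [<- _|_ /eqP]; last by rewrite oner_eq0.
by rewrite SE (climb_seed cl') !alt_seed_other.
Qed.

Lemma climb_up k k' x v E S w e n :
  (forall i, pairing x (lab u (E0 i)) = 0 -> i = k \/ i = k') ->
  pairing x (lab u (E0 k)) = 0 -> pairing x (lab u (E0 k')) = 0 ->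
  climb k k' n v E S \/ climb k' k n v E S ->
  joins e v w -> pairing x (lab v e) = 0 -> 0 < pairing rho (lab v e) ->
  exists2 i, E i = e & let E1 := transport v w (E i) E in
    climb k k' n.+1 w E1 (mutate i S) \/ climb k' k n.+1 w E1 (mutate i S).
Proof.
move=> zero xk xk' cl jw xe re.
have ms : marked v E S by case: cl => /climb_reach /(reach_marked HB).
have [i iE] := marked_surj ms (joins_incl jw); subst e; exists i => //.
have {}zero : i = k \/ i = k'.
  by apply: zero; case: cl => cl; rewrite -xe (climb_pairing cl).
case: n cl => [|n] cl.
  have [vu EE SE] : [/\ v = u, E = E0 & S = S0] by case: cl.
  by subst v E S; case: zero => iE; subst i; [left|right]; exists u, E0, S0.
have step l l' : (i = l \/ i = l') -> climb l l' n.+1 v E S ->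
    climb l l' n.+2 w (transport v w (E i) E) (mutate i S).
  move=> il cl1; have := climb_last cl1 => neg.
  (* The wall crossed last is now negative, so an upward step uses the other letter. *)
  have iE : i = letter l l' n.+1.
    have : i != letter l l' n.
      by apply: contraTneq re => ->; rewrite -leNgt ltW.
    rewrite /letter /=; case: odd => /eqP ni; by case: il ni => [->|->].
  by exists v, E, S; rewrite -iE.
by case: cl => cl; [left|right]; apply: step => //; case: zero; [right|left].
Qed.

Lemma climb_exists k k' x v :
  (forall i, pairing x (lab u (E0 i)) = 0 -> i = k \/ i = k') ->
  pairing x (lab u (E0 k)) = 0 -> pairing x (lab u (E0 k')) = 0 ->
  star_desc x v u -> exists n E S, climb k k' n v E S \/ climb k' k n v E S.
Proof.
move=> zero xk xk'; suff gen u' : star_desc x v u' -> u' = u ->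
    exists n E S, climb k k' n v E S \/ climb k' k n v E S by move=> /gen; exact.
elim=> [v1 ->|v1 w u1 e j1 xe re _ IH uu]; first by exists 0%N, E0, S0; left.
have [n [E [S cl]]] := IH uu.
have jw := joinsC j1.
have xe' : pairing x (lab w e) = 0 by rewrite (lab_opp j1).1 pairingNr xe oppr0.
have re' : 0 < pairing rho (lab w e) by rewrite (lab_opp j1).1 pairingNr oppr_gt0.
have [i _ cl'] := climb_up zero xk xk' cl jw xe' re'.
by exists n.+1, (transport w v1 (E i) E), (mutate i S).
Qed.

End Climb.

Lemma star_lift x v u E0 S0 : star_desc x v u -> reach true u E0 S0 ->
  exists E S, reach true v E S /\
    forall i, pairing x (lab v (E i)) = pairing x (lab u (E0 i)).
Proof.
move=> vu r0; elim: vu r0 => [v1|v1 w u1 e j1 xe re _ IH] r0.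
  by exists E0, S0.
have [E [S [r hE]]] := IH r0; have jw := joinsC j1; have m1 := reach_marked HB r.
have [k kE] := marked_surj m1 (joins_incl jw); subst e.
have xk : pairing x (lab w (E k)) = 0 by rewrite (lab_opp j1).1 pairingNr xe oppr0.
exists (transport w v1 (E k) E), (mutate k S); split.
  by apply: reach_step => // _; rewrite (lab_opp j1).1 pairingNr oppr_gt0.
have [_ labE] := transport_marked HB m1 jw; move=> i; rewrite labE -hE.
case: eqP => [->|_]; first by rewrite pairingNr xk oppr0.
by rewrite pairingDr pairingZr xk mulr0 addr0.
Qed.

Lemma reach_up_unique v E S E' S' :
  reach true v E S -> reach true v E' S' -> same_clusters E S E' S'.
Proof.
elim/(arrow_ind desc): v E S E' S' => v IH E S E' S' r r'.
have mS := reach_marked HB r; have mS' := reach_marked HB r'.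
have base_pos (F : I -> edge G) e : base_marking F -> incident (base Fr) e ->
    0 < pairing rho (lab (base Fr) e).
  move=> hF be; have mF := base_marked HB hF.
  have [i iE] := marked_surj mF be; rewrite -iE (hF i).2; apply: nonneg_root_rho.
    by apply/forallP => j; rewrite ffunE ler0n.
  by move=> /ffunP /(_ i); rewrite !ffunE eqxx => /eqP; rewrite oner_eq0.
have down v1 e : joins e v1 v -> 0 < pairing rho (lab v1 e) ->
    pairing rho (lab v e) < 0 /\ arrow v v1.
  move=> j h; have h' : pairing rho (lab v e) < 0.
    by rewrite (lab_opp j).1 pairingNr oppr_lt0.
  split=> //; exists e; split; first exact: joinsC.
  by apply/(incident_sgn (joins_incl (joinsC j))).2.
(* A last upward step into v leaves a negative label at v, while all labels at the base are
   positive: either both paths are trivial or neither is. *)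
case: (reach_inv r) => [[vb hE SE]|[v1 [E1 [S1 [k1 [r1 j1 h1 EE SE]]]]]];
case: (reach_inv r') => [[vb' hE' SE']|[v2 [E2 [S2 [k2 [r2 j2 h2 EE' SE']]]]]].
- subst v S S'; move=> i j ij; have -> : i = j; last by [].
  by apply: (@simple_root_inj R); rewrite -(hE i).2 -(hE' j).2 ij.
- have [h _] := down _ _ j2 (h2 isT); subst v.
  by move: (lt_trans h (base_pos _ _ hE (joins_incl (joinsC j2)))); rewrite ltxx.
- have [h _] := down _ _ j1 (h1 isT); subst v.
  by move: (lt_trans h (base_pos _ _ hE' (joins_incl (joinsC j1)))); rewrite ltxx.
have {h1}h1 := h1 isT; have {h2}h2 := h2 isT.
have [ne a1] := down _ _ j1 h1; have [nf a2] := down _ _ j2 h2.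
have m1 := reach_marked HB r1; have m2 := reach_marked HB r2.
have [ef|ef] := pselect (E1 k1 = E2 k2).
  have e12 : v1 = v2 by apply: joins_inj (joinsC j1) _; rewrite ef; exact: joinsC.
  subst v2 E S E' S'; apply: same_clusters_step => //; exact: IH r1 r2.
set e := E1 k1 in j1 h1 ne ef EE; set f := E2 k2 in j2 h2 nf ef EE'.
have ve := joins_incl (joinsC j1); have vf := joins_incl (joinsC j2).
have [ie ieE] := marked_surj mS ve; have [jf jfE] := marked_surj mS vf.
have [g [gE _]] := marked_dual mS.
(* a point in the relative interior of the face cut out by the walls e and f *)
pose x := \sum_(i | (i != ie) && (i != jf)) g i.
have xE i : pairing x (lab v (E i)) = ((i != ie) && (i != jf))%:R.
  rewrite pairing_suml; case: (boolP (_ && _)) => hi.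
    rewrite (bigD1 i) //= gE eqxx big1 ?addr0 // => j /andP[_ /negPf ji].
    by rewrite gE ji.
  by rewrite big1 // => j hj; rewrite gE; case: (eqVneq j i) hi => // <-; rewrite hj.
have xe : pairing x (lab v e) = 0 by rewrite -ieE xE eqxx.
have xf : pairing x (lab v f) = 0 by rewrite -jfE xE eqxx andbF.
have xzero h : incident v h -> pairing x (lab v h) = 0 -> h = e \/ h = f.
  move=> /(marked_surj mS)[i <-]; rewrite xE -ieE -jfE.
  case: (eqVneq i ie) => [->|_]; first by left.
  case: (eqVneq i jf) => [->|_]; first by right.
  by move=> /eqP; rewrite oner_eq0.
have vx : cone v x by apply/coneP => h /(marked_surj mS)[i <-]; rewrite xE ler0n.
have [u v1u lu] := star_desc_exists HB desc (cone_step HB desc (joinsC j1) xe vx).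
have [u' v2u' lu'] := star_desc_exists HB desc (cone_step HB desc (joinsC j2) xf vx).
have uu := lex_interior_unique HB desc lu lu'; subst u'.
have [E0 [S0 r0]] := reach_up_exists HB desc u; have m0 := reach_marked HB r0.
(* Lifting a marking of u to v names the walls e and f by indices k and k' at u; these are exactly
   the indices whose label at u vanishes at x. *)
have vu : star_desc x v u := star_desc_step (joinsC j1) xe ne v1u.
have [F [T [rF FE]]] := star_lift vu r0; have mF := reach_marked HB rF.
have [k kE] := marked_surj mF ve; have [k' kE'] := marked_surj mF vf.
have kk' : k != k' by apply: contra_notN ef => /eqP kk; rewrite -kE -kE' kk.
have xk : pairing x (lab u (E0 k)) = 0 by rewrite -FE kE.
have xk' : pairing x (lab u (E0 k')) = 0 by rewrite -FE kE'.
have zero i : pairing x (lab u (E0 i)) = 0 -> i = k \/ i = k'.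
  rewrite -FE => /(xzero _ (marked_inc mF i)); rewrite -kE -kE'.
  by case=> /(marked_inj mF); [left|right].
have pos i : pairing x (lab u (E0 i)) = 0 -> 0 < pairing rho (lab u (E0 i)).
  by move=> xi; case: (lu _ (marked_inc m0 i)) => [|[]//]; rewrite xi ltxx.
have neg i F' T' : marked v F' T' -> pairing x (lab v (F' i)) = 0 ->
    pairing rho (lab v (F' i)) < 0.
  by move=> mF' /(xzero _ (marked_inc mF' i)) [] ->.
(* By the induction hypothesis at v3, the path up to v3 may be replaced by a climb from u, which the
   last step then extends. *)
have side v3 E3 S3 E4 S4 k3 h : reach true v3 E3 S3 -> arrow v v3 ->
    joins h v3 v -> h = E3 k3 -> 0 < pairing rho (lab v3 h) ->
    pairing x (lab v h) = 0 -> star_desc x v3 u ->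
    E4 = transport v3 v h E3 -> S4 = mutate k3 S3 ->
    exists n F' T', [/\ climb u E0 S0 k k' n v F' T' \/ climb u E0 S0 k' k n v F' T',
      marked v F' T' & same_clusters E4 S4 F' T'].
  move=> r3 a3 j3 hE h3 xh v3u -> ->.
  have [n [F3 [T3 cl3]]] := climb_exists r0 zero xk xk' v3u.
  have xh' : pairing x (lab v3 h) = 0.
    by rewrite (lab_opp (joinsC j3)).1 pairingNr xh oppr0.
  have [i iE cl] := climb_up r0 zero xk xk' cl3 j3 xh' h3.
  have rF3 : reach true v3 F3 T3 by case: cl3 => /(climb_reach r0).
  exists n.+1, (transport v3 v (F3 i) F3), (mutate i T3); split=> //.
    by case: cl => /(climb_reach r0) /(reach_marked HB).
  have j3' : joins (E3 k3) v3 v by rewrite -hE.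
  have k3i : E3 k3 = F3 i by rewrite -hE iE.
  have sim3 := IH _ a3 _ _ _ _ r3 rF3.
  rewrite hE; exact: (same_clusters_step (reach_marked HB r3) (reach_marked HB rF3) sim3).
have [n [F1 [T1 [c1 mF1 sim1]]]] := side _ _ _ _ _ _ _ r1 a1 j1 erefl h1 xe v1u EE SE.
have [m [F2 [T2 [c2 mF2 sim2]]]] := side _ _ _ _ _ _ _ r2 a2 j2 erefl h2 xf v2u' EE' SE'.
apply: (same_clusters_trans mS mF1 sim1).
apply: same_clusters_sym; apply: (same_clusters_trans mS' mF2 sim2).
have rk := pos _ xk; have rk' := pos _ xk'; have k'k : k' != k by rewrite eq_sym.
have negs F' T' l : climb u E0 S0 k k' l v F' T' \/ climb u E0 S0 k' k l v F' T' ->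
    marked v F' T' -> pairing rho (lab v (F' k)) < 0 /\ pairing rho (lab v (F' k')) < 0.
  by move=> cl mF'; split; apply: neg mF' _; case: cl => cl;
    rewrite (climb_pairing r0 cl).
have [n1 n1'] := negs _ _ _ c1 mF1; have [n2 n2'] := negs _ _ _ c2 mF2.
(* Both last steps might lie on the same side of the star; then the climbs have equal length and
   coincide. *)
have same l l' : l != l' -> climb u E0 S0 l l' n v F1 T1 -> climb u E0 S0 l l' m v F2 T2 ->
    (forall j, pairing rho (lab v (F1 (letter l l' j))) < 0) ->
    (forall j, pairing rho (lab v (F2 (letter l l' j))) < 0) ->
    same_clusters F2 T2 F1 T1.
  move=> ll cl1 cl2 neg1 neg2; have nm : n = m.
    apply/eqP; rewrite eqn_leq.
    by rewrite (climb_length r0 ll cl2 cl1) // (climb_length r0 ll cl1 cl2).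
  subst m; have [_ -> ->] := climb_det cl1 cl2; exact: same_clusters_refl mF2.
case: c1 c2 => c1 [] c2.
- by apply: same kk' c1 c2 _ _ => j; rewrite /letter; case: odd.
(* One of the two exchange entries at u is nonnegative; [polygon] is applied with the matching order
   of the sides. *)
- by case: (marked_sign k k' m0) => sg; [apply: same_clusters_sym|];
    [apply: (polygon r0 kk')|apply: (polygon r0 k'k)]; eauto.
- by case: (marked_sign k k' m0) => sg; [|apply: same_clusters_sym];
    [apply: (polygon r0 kk')|apply: (polygon r0 k'k)]; eauto.
- by apply: same k'k c1 c2 _ _ => j; rewrite /letter; case: odd.
Qed.

(** Arbitrary paths are compared with upward ones edge by edge, so that [reach_up_unique] settles
    the independence of the path. *)
Lemma reach_same_clusters v E S E' S' :
  reach false v E S -> reach true v E' S' -> same_clusters E S E' S'.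
Proof.
move=> r; elim: r E' S' => [{}E hE|{}v {}E {}S w k r IH jw _] E' S' r'.
  by apply: reach_up_unique r'; constructor.
have mS := reach_marked HB r.
have [E1 [S1 r1]] := reach_up_exists HB desc v; have m1 := reach_marked HB r1.
have [k1 k1E] := marked_surj m1 (joins_incl jw).
have jw1 : joins (E1 k1) v w by rewrite k1E.
have sim := same_clusters_step mS m1 (IH _ _ r1) (esym k1E) jw.
have [mT _] := transport_marked HB mS jw; have [mT1 _] := transport_marked HB m1 jw1.
apply: (same_clusters_trans mT mT1 sim).
have [up|dn|e0] := ltrgt0P (pairing rho (lab v (E1 k1))).
- by apply: reach_up_unique r'; apply: reach_step.
- (* climb back from w to v, where uniqueness applies, then cross again *)
  have m' := reach_marked HB r'; have p' := reach_positive r'.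
  have [k2 k2E] := marked_surj m' (joins_incl (joinsC jw1)).
  have jv : joins (E' k2) w v by rewrite k2E; exact: joinsC.
  have rv : reach true v (transport w v (E' k2) E') (mutate k2 S').
    by apply: reach_step => // _; rewrite k2E (lab_opp jw1).1 pairingNr oppr_gt0.
  have mv := reach_marked HB rv; have [tK mK] := transportK m' p' jv.
  set E2 := transport w v (E' k2) E' in rv mv tK *.
  have E2k : E2 k2 = E' k2 by rewrite /E2 /transport /edge_transport asboolT.
  have k12 : E1 k1 = E2 k2 by rewrite E2k k2E.
  have := same_clusters_step m1 mv (reach_up_unique r1 rv) k12 jw1.
  by rewrite mK => h i j ij; apply: h; rewrite tK.
- have := incident_rho_neq0 (joins_incl jw1); by rewrite e0 eqxx.
Qed.

Lemma reach_relabeling v E S E' S' : reach false v E S -> reach false v E' S' ->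
  same_up_to_relabeling S S'.
Proof.
move=> r r'; have [E1 [S1 r1]] := reach_up_exists HB desc v.
have m := reach_marked HB r; have m' := reach_marked HB r'.
have m1 := reach_marked HB r1.
have sim := same_clusters_trans m m1 (reach_same_clusters r r1)
  (same_clusters_sym (reach_same_clusters r' r1)).
have [s [h1 h2 h3] _] := marked_relabels m m' sim.
by exists s.
Qed.

Lemma seed_from_reach u prev E S s : reach false u E S -> cover_from u prev s ->
  exists E', reach false (last u [seq eu.2 | eu <- s]) E' (seed_from u E S s).
Proof.
elim: s u prev E S => [|[e w] s IH] u prev E S r /=; first by exists E.
move=> [jw _ cs]; have mS := reach_marked HB r.
have [k kE] := marked_surj mS (joins_incl jw).
case: pickP => [l /asboolP lE|/(_ k)]; last by rewrite kE asboolT.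
subst e; have -> : l = k by apply: (marked_inj mS).
by apply: IH cs; apply: reach_step.
Qed.

Lemma descending_ample : ample Fr.
Proof.
have cover_reach s : cover_vertex s ->
    exists E, reach false (cover_proj s) E (cover_seed s).
  case: s => [_|[e w] s cs].
    by have [E hE] := base_marking_exists Fr; exists E; constructor.
  by apply: seed_from_reach cs; constructor; exact: base_indexP.
move=> s t /cover_reach[E r] /cover_reach[E' r'] st; rewrite st in r.
exact: reach_relabeling r r'.
Qed.

End Ample.

Theorem theorem4p19 (R : realType) (I : finType) (B : I -> I -> int)
    (delta : I -> R) (HB : skew_symmetrized_by B delta)
    (Fr : framework B delta) :
  descending Fr -> exact_framework Fr /\ polyhedral Fr /\ well_connected Fr.
Proof.
move=> desc; split; [split|split].
- exact: descending_injective.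
- exact: descending_ample.
- exact: descending_polyhedral.
- exact: descending_well_connected.
Qed.
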